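(* Let $\mu\in V_{n,m}$ be a nonsingular algebra of type $(n,m)$ ($n,m\ge1$) and $\mathfrak{n}=\mathfrak{n}_1\oplus\mathfrak{n}_2$. Then the following conditions are equivalent: (i) $\mathfrak{n}$ admits an inner product (with $\mathfrak{n}_1\perp\mathfrak{n}_2$) for which there exist $a,b<0$ such that $\sum_i J_\mu(Z_i)^2=aI$ and $\operatorname{tr}(J_\mu(Z_i)J_\mu(Z_j))=b\,\delta_{ij}$ for all $i,j$, for any (equivalently, some) orthonormal basis $\{Z_i\}$ of $\mathfrak{n}_2$. (ii) The Lie algebra $(\mathfrak{n},\mu)$ admits a nilsoliton inner product (or equivalently, $\mu$ is a critical point of the functional $F_m$ defined by some inner product $\langle\cdot,\cdot\rangle$ on $\mathfrak{n}$ with $\mathfrak{n}_1\perp\mathfrak{n}_2$). (iii) The $\mathrm{SL}_m\times\mathrm{SL}_n$-orbit of $\mu$ is closed in $V_{n,m}$ (in the vector space topology).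
   Context: Let $\mathfrak{n}_1,\mathfrak{n}_2$ be real vector spaces of dimensions $m,n$, and $V_{n,m}=\Lambda^2\mathfrak{n}_1^*\otimes\mathfrak{n}_2$ the space of bilinear skew-symmetric maps $\mu:\mathfrak{n}_1\times\mathfrak{n}_1\to\mathfrak{n}_2$. Each $\mu$ is regarded as a $2$-step nilpotent Lie bracket on $\mathfrak{n}=\mathfrak{n}_1\oplus\mathfrak{n}_2$ (with $\mathfrak{n}_2$ central); it is of type $(n,m)$ if $\mu(\mathfrak{n}_1,\mathfrak{n}_1)=\mathfrak{n}_2$. The group $\mathrm{GL}_m\times\mathrm{GL}_n=\mathrm{GL}(\mathfrak{n}_1)\times\mathrm{GL}(\mathfrak{n}_2)$ acts on $V_{n,m}$ by $(\psi,\varphi)\cdot\mu=\varphi\,\mu(\psi^{-1}\cdot,\psi^{-1}\cdot)$, with $\mathrm{SL}_m\times\mathrm{SL}_n$ acting by restriction. Given an inner product on $\mathfrak{n}$ with $\mathfrak{n}_1\perp\mathfrak{n}_2$, $J_\mu:\mathfrak{n}_2\to\mathfrak{so}(\mathfrak{n}_1)$ is defined by $\langle J_\mu(Z)X,Y\rangle=\langle\mu(X,Y),Z\rangle$. $\mu$ is nonsingular if $J_\mu(Z)$ is invertible for every nonzero $Z\in\mathfrak{n}_2$ (independent of the inner product). An inner product on $\mathfrak{n}$ is a nilsoliton for $(\mathfrak{n},\mu)$ if the left-invariant Riemannian metric $g$ it determines on the simply connected nilpotent Lie group with Lie algebra $(\mathfrak{n},\mu)$ is a Ricci soliton, i.e.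 the Ricci flow solution starting at $g$ evolves only by time-dependent scaling and pull-back by diffeomorphisms. In this setting this is known to be equivalent to: the Ricci operator of $g$ equals $cI+D$ for some $c\in\mathbb{R}$ and some derivation $D$ of $(\mathfrak{n},\mu)$. The functional $F_m$: an inner product on $\mathfrak{n}$ with $\mathfrak{n}_1\perp\mathfrak{n}_2$ induces the inner product $\langle\mu,\lambda\rangle=\sum_{i,j}\langle\mu(X_i,X_j),\lambda(X_i,X_j)\rangle$ on $V_{n,m}$ ($\{X_i\}$ orthonormal basis of $\mathfrak{n}_1$). Let $\pi(\alpha,\beta)\mu=\beta\mu(\cdot,\cdot)-\mu(\alpha\cdot,\cdot)-\mu(\cdot,\alpha\cdot)$ for $(\alpha,\beta)\in\mathfrak{gl}_m\oplus\mathfrak{gl}_n$. The moment map $m:V_{n,m}\to\mathrm{sym}(m)\oplus\mathrm{sym}(n)$ is defined by $m(0)=0$ and $\langle m(\mu),(\alpha,\beta)\rangle=\frac{1}{\|\mu\|^2}\langle\pi(\alpha,\beta)\mu,\mu\rangle$ for all symmetric $\alpha,\beta$ and $\mu\neq0$, where the inner product on $\mathrm{sym}(m)\oplus\mathrm{sym}(n)$ is $\operatorname{tr}\alpha\alpha'+\operatorname{tr}\beta\beta'$. Then $F_m(\mu)=\|m(\mu)\|^2$ (smooth and scaling invariant on $V_{n,m}\smallsetminus\{0\}$). *)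

(* Defs.v *)
From HB Require Import structures.
From mathcomp Require Import all_boot all_order all_algebra sesquilinear.
From mathcomp Require Import all_classical all_reals all_analysis.

Set Implicit Arguments.
Unset Strict Implicit.
Unset Printing Implicit Defensive.

Import Order.TTheory GRing.Theory Num.Theory.
Import numFieldNormedType.Exports.

Local Open Scope classical_set_scope.
Local Open Scope ring_scope.

(* Conventions: n1 = 'rV[R]_m and n2 = 'rV[R]_n, so n = n1 (+) n2 is
   'rV[R]_(m + n).  A square matrix A stands for the operator x |-> x *m A;
   traces and squares do not depend on this side convention.  Inner products
   are the positive definite symmetric forms {dot U for idfun} of sesquilinear. *)

Section InnerProduct.
Variables (R : realType) (N : nat).
Implicit Types (g : 'rV[R]_N -> 'rV[R]_N -> R) (f : 'rV[R]_N -> R).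

(* xget returns the default 0 only if the set is empty: for an inner product g
   and a linear form f the representing vector exists and is unique. *)
Definition riesz g f : 'rV[R]_N := xget 0 [set v | forall y, g v y = f y].

Definition orthonormal_basis g (X : 'I_N -> 'rV[R]_N) : Prop :=
  forall i j, g (X i) (X j) = (i == j)%:R.

(* Some orthonormal basis; V_dot below does not depend on the choice. *)
Definition onb g : 'I_N -> 'rV[R]_N :=
  xget (fun=> 0) [set X | orthonormal_basis g X].

Definition self_adjoint g (A : 'M[R]_N) : Prop :=
  forall x y, g (x *m A) y = g x (y *m A).

End InnerProduct.

(* Metric Lie algebras: invariants of the left-invariant metric with value g at
   the identity of a Lie group whose Lie algebra is ('rV[R]_N, br), expressed on
   left-invariant vector fields. *)
Section MetricLieAlgebra.
Variables (R : realType) (N : nat).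
Variables (br : 'rV[R]_N -> 'rV[R]_N -> 'rV[R]_N) (g : 'rV[R]_N -> 'rV[R]_N -> R).
Implicit Types X Y Z : 'rV[R]_N.

(* Koszul's formula; the derivative terms vanish on left-invariant fields. *)
Definition levi_civita X Y : 'rV[R]_N :=
  riesz g (fun Z => 2^-1 * (g (br X Y) Z - g (br Y Z) X + g (br Z X) Y)).

Definition curvature X Y Z : 'rV[R]_N :=
  levi_civita X (levi_civita Y Z) - levi_civita Y (levi_civita X Z)
  - levi_civita (br X Y) Z.

Definition ricci X Y : R := \tr (lin1_mx (fun Z => curvature Z X Y)).

Definition ricci_operator : 'M[R]_N := lin1_mx (fun X => riesz g (ricci X)).

Definition derivation (D : 'M[R]_N) : Prop :=
  forall X Y, br X Y *m D = br (X *m D) Y + br X (Y *m D).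

(* For a left-invariant metric on a simply connected nilpotent Lie group, this
   is equivalent to being a Ricci soliton (Lauret). *)
Definition nilsoliton : Prop :=
  exists (c : R) (D : 'M[R]_N), derivation D /\ ricci_operator = c%:M + D.

End MetricLieAlgebra.

Section TwoStep.
Variables (R : realType) (m n : nat).
Local Notation n1 := 'rV[R]_m.
Local Notation n2 := 'rV[R]_n.
(* Bilinear maps n1 x n1 -> n2, a matrix T being the map
   (x, y) |-> sum_(i, j) x_i y_j (row (mxvec_index i j) T); this puts the usual
   vector space topology on them. *)
Local Notation tensor := 'M[R]_(m * m, n).
Implicit Types (mu nu : tensor) (g : 'rV[R]_(m + n) -> 'rV[R]_(m + n) -> R).

Definition bil mu (x y : n1) : n2 := mxvec (x^T *m y) *m mu.

Definition Vnm : set tensor := [set mu | forall x y, bil mu x y = - bil mu y x].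

Definition lie_bracket mu (u v : 'rV[R]_(m + n)) : 'rV[R]_(m + n) :=
  row_mx 0 (bil mu (lsubmx u) (lsubmx v)).

(* mu(n1, n1) is the linear span of the brackets; no scalars are needed in
   the sum since mu is bilinear. *)
Definition of_type mu : Prop :=
  forall z : n2, exists (k : nat) (x y : 'I_k -> n1),
    z = \sum_(i < k) bil mu (x i) (y i).

Definition n1_perp_n2 g : Prop :=
  forall (x : n1) (z : n2), g (row_mx x 0) (row_mx 0 z) = 0.

Definition on_n1 g (x y : n1) : R := g (row_mx x 0) (row_mx y 0).
Definition on_n2 g (z w : n2) : R := g (row_mx 0 z) (row_mx 0 w).

Definition Jmap g mu (Z : n2) : 'M[R]_m :=
  lin1_mx (fun X => riesz (on_n1 g) (fun Y => on_n2 g (bil mu X Y) Z)).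

(* The property does not depend on the inner product. *)
Definition nonsingular mu : Prop :=
  exists g : {dot 'rV[R]_(m + n) for idfun},
    n1_perp_n2 g /\ forall Z : n2, Z != 0 -> Jmap g mu Z \in unitmx.

Definition J_condition g mu (a b : R) (Z : 'I_n -> n2) : Prop :=
  \sum_i Jmap g mu (Z i) *m Jmap g mu (Z i) = a%:M /\
  forall i j, \tr (Jmap g mu (Z i) *m Jmap g mu (Z j)) = b * (i == j)%:R.

(* Orbit of mu under (psi, phi).mu = phi mu(psi^-1 ., psi^-1 .). *)
Definition SL_orbit mu : set tensor :=
  [set nu | exists (psi : 'M[R]_m) (phi : 'M[R]_n),
     [/\ \det psi = 1, \det phi = 1 & forall x y,
       bil nu x y = bil mu (x *m invmx psi) (y *m invmx psi) *m phi]].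

Definition pi_rep (alpha : 'M[R]_m) (beta : 'M[R]_n) (f : n1 -> n1 -> n2)
    (x y : n1) : n2 :=
  f x y *m beta - f (x *m alpha) y - f x (y *m alpha).

Definition V_dot g (f h : n1 -> n1 -> n2) : R :=
  let X := onb (on_n1 g) in
  \sum_i \sum_j on_n2 g (f (X i) (X j)) (h (X i) (X j)).

Definition is_moment g mu (ab : 'M[R]_m * 'M[R]_n) : Prop :=
  [/\ self_adjoint (on_n1 g) ab.1, self_adjoint (on_n2 g) ab.2 &
      if mu == 0 then ab = 0 else
      forall (alpha : 'M[R]_m) (beta : 'M[R]_n),
        self_adjoint (on_n1 g) alpha -> self_adjoint (on_n2 g) beta ->
        \tr (ab.1 *m alpha) + \tr (ab.2 *m beta) =
        (V_dot g (bil mu) (bil mu))^-1 *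
          V_dot g (pi_rep alpha beta (bil mu)) (bil mu)].

(* For an inner product g there is exactly one such pair. *)
Definition moment g mu : 'M[R]_m * 'M[R]_n := xget 0 [set ab | is_moment g mu ab].

Definition F_m g mu : R :=
  let ab := moment g mu in \tr (ab.1 *m ab.1) + \tr (ab.2 *m ab.2).

(* F_m is smooth off 0, so its differential along Vnm is given by directional
   derivatives; for mu and nu in Vnm they only involve values of F_m on Vnm. *)
Definition critical_point g mu : Prop :=
  forall nu, Vnm nu -> is_derive mu nu (F_m g : tensor -> R^o) 0.

End TwoStep.

(* Main.v *)
Require Import Defs.
From HB Require Import structures.
From mathcomp Require Import all_boot all_order all_algebra sesquilinear.
From mathcomp Require Import all_classical all_reals all_analysis.
From mathcomp Require Import ring lra.
Import Order.TTheory GRing.Theory Num.Theory.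
Import numFieldNormedType.Exports.
Local Open Scope classical_set_scope.
Local Open Scope ring_scope.
Set Implicit Arguments.
Unset Strict Implicit.
Unset Printing Implicit Defensive.

(* In an orthonormal frame mu becomes a tuple C of skew matrices C_l = J(Z_l).
   Condition (i) says that sum C_l^2 and the Gram matrix (tr C_k C_l) are scalar,
   while the nilsoliton condition and the critical point condition both reduce to
   one equation: 1/2 (S C_l + C_l S) + 1/4 sum_k G_kl C_k = c C_l for all l, with
   S = sum C_l^2 and G_kl = tr (C_k C_l).  For nonsingular C this equation forces
   S and G to be scalar.  Closedness of the SL x SL orbit is then a Kempf-Ness
   argument: a vector of minimal norm in a closed orbit satisfies (i), by first
   variation along unipotent one-parameter groups.  Conversely, under (i), points
   of the orbit of bounded norm are reached by group elements of bounded size. *)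

(** Arbitrary group elements cannot be bounded in the converse: the stabiliser of [C] in SL x SL may
    be noncompact (for n = 1 it is a symplectic group), so a bounded part of the orbit is also
    reached by unbounded pairs. Each orbit point is therefore represented by a pair of least
    Frobenius norm, and only such pairs are shown to stay bounded. A nilsoliton inner product need
    not make n1 and n2 orthogonal. A block triangular frame absorbs this: the bracket depends only
    on n1-components and takes values in n2, so the off-diagonal block of the frame never enters
    [C]. Orthonormal frames are elements of GL while the orbits are under SL. Closedness passes from
    the tuple in a frame back to mu because SL is normal in GL. *)

Section Tuples.
Variable R : realType.

Lemma tr_mul_trmx_sum p q (A B : 'M[R]_(p, q)) :
  \tr (A *m B^T) = \sum_i \sum_j A i j * B i j.
Proof.
apply: eq_bigr => i _; rewrite mxE; apply: eq_bigr => j _.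
by rewrite mxE.
Qed.

Lemma tr_mul_trmx_ge0 p q (A : 'M[R]_(p, q)) : 0 <= \tr (A *m A^T).
Proof.
rewrite tr_mul_trmx_sum; apply: sumr_ge0 => i _; apply: sumr_ge0 => j _.
by rewrite -expr2 sqr_ge0.
Qed.

Lemma sqr_entry_le_tr p q (A : 'M[R]_(p, q)) i j : A i j ^+ 2 <= \tr (A *m A^T).
Proof.
rewrite tr_mul_trmx_sum (bigD1 i) //= (bigD1 j) //= -expr2 -addrA lerDl.
apply: addr_ge0; last first.
  apply: sumr_ge0 => k _; apply: sumr_ge0 => l _.
  by rewrite -expr2 sqr_ge0.
by apply: sumr_ge0 => k _; rewrite -expr2 sqr_ge0.
Qed.

Lemma tr_mul_trmx_eq0 p q (A : 'M[R]_(p, q)) : \tr (A *m A^T) = 0 -> A = 0.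
Proof.
move=> h; apply/matrixP => i j; rewrite mxE; apply/eqP.
by rewrite -sqrf_eq0 eq_le sqr_ge0 -h sqr_entry_le_tr.
Qed.

(** * Tuples of matrices, the group action and its invariants *)

Variables m n : nat.
Local Notation tuple := ('I_n -> 'M[R]_m).
Implicit Types (C D : tuple) (A B : 'M[R]_m) (phi psi : 'M[R]_n).

(* The slices of (A^-1, phi) . mu are act A phi C, where C are those of mu. *)
Definition act A phi C : tuple :=
  fun l => \sum_k phi k l *: (A *m C k *m A^T).

Definition skew C := forall l, (C l)^T = - C l.

(** The operator J(z) for z with coordinates z_l in the orthonormal frame of n2. *)
Definition pencil C (z : 'rV[R]_n) := \sum_l z 0 l *: C l.

Definition nonsing C := forall z : 'rV[R]_n, z != 0 -> pencil C z \in unitmx.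

Definition sumsq C := \sum_l C l *m C l.

Definition gram C := \matrix_(k, l) \tr (C k *m C l).

Definition einstein C a b := sumsq C = a%:M /\ gram C = b%:M.

Definition soliton C c := forall l,
  2^-1 *: (sumsq C *m C l + C l *m sumsq C)
  + 4^-1 *: (\sum_k gram C k l *: C k) = c *: C l.

Definition ssq C := \sum_l \tr (C l *m (C l)^T).

Definition orbit C : set tuple :=
  [set D | exists A phi, [/\ \det A = 1, \det phi = 1 & D = act A phi C]].

Lemma act1 C : act 1%:M 1%:M C = C.
Proof.
apply/funext => l; rewrite /act (bigD1 l) //= big1 ?addr0.
  by rewrite mxE eqxx scale1r trmx1 mul1mx mulmx1.
by move=> k kl; rewrite mxE (negPf kl) scale0r.
Qed.

(** The orders come from the row-vector convention: the action substitutes [x *m A] for the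
    arguments, so [B] is applied after [A], and multiplies values on the right, so [phi] comes after
    [psi]. *)
Lemma act_comp A phi B psi C :
  act A phi (act B psi C) = act (A *m B) (psi *m phi) C.
Proof.
apply/funext => l; rewrite /act.
under eq_bigr => k _ do rewrite mulmx_sumr mulmx_suml scaler_sumr.
rewrite exchange_big /=; apply: eq_bigr => k _.
rewrite [X in X *: _]mxE scaler_suml; apply: eq_bigr => j _.
by rewrite -scalemxAr -scalemxAl scalerA mulrC trmx_mul !mulmxA.
Qed.

Lemma skew_act A phi C : skew C -> skew (act A phi C).
Proof.
move=> sC l; rewrite /act linear_sum /= -sumrN; apply: eq_bigr => k _.
by rewrite linearZ /= !trmx_mul trmxK sC mulNmx mulmxN mulmxA scalerN.
Qed.

Lemma pencil_act A phi C z :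
  pencil (act A phi C) z = A *m pencil C (z *m phi^T) *m A^T.
Proof.
rewrite /pencil /act mulmx_sumr mulmx_suml.
under eq_bigr => l _ do rewrite scaler_sumr.
rewrite exchange_big /=; apply: eq_bigr => k _.
rewrite -scalemxAr -scalemxAl [X in X *: _]mxE scaler_suml.
by apply: eq_bigr => j _; rewrite scalerA mxE.
Qed.

Lemma nonsing_act A phi C : A \in unitmx -> phi \in unitmx ->
  nonsing C -> nonsing (act A phi C).
Proof.
move=> uA uphi nC z z0; rewrite pencil_act !unitmx_mul uA unitmx_tr uA andbT /=.
apply: nC; apply: contra z0 => /eqP h; apply/eqP.
by rewrite -(mulmx1 z) -trmx1 -(mulVmx uphi) trmx_mul mulmxA h mul0mx.
Qed.

Lemma sumsq_act A phi C : A^T *m A = 1%:M -> phi *m phi^T = 1%:M ->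
  sumsq (act A phi C) = A *m sumsq C *m A^T.
Proof.
move=> hA hphi; rewrite /sumsq mulmx_sumr mulmx_suml /act.
transitivity (\sum_k \sum_j (phi *m phi^T) k j *: (A *m (C k *m C j) *m A^T)).
  under eq_bigr => l _ do rewrite mulmx_suml.
  rewrite exchange_big /=; apply: eq_bigr => k _.
  under eq_bigr => l _ do rewrite mulmx_sumr.
  rewrite exchange_big /=; apply: eq_bigr => j _.
  rewrite mxE scaler_suml; apply: eq_bigr => l _.
  rewrite -scalemxAl -scalemxAr scalerA mxE; congr (_ *: _).
  by rewrite -!mulmxA (mulmxA A^T A) hA mul1mx !mulmxA.
apply: eq_bigr => k _; rewrite hphi (bigD1 k) //= big1 ?addr0.
  by rewrite mxE eqxx scale1r.
by move=> j jk; rewrite mxE eq_sym (negPf jk) scale0r.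
Qed.

Lemma gram_act A phi C : A^T *m A = 1%:M ->
  gram (act A phi C) = phi^T *m gram C *m phi.
Proof.
move=> hA; apply/matrixP => k l; rewrite !mxE /act mulmx_suml raddf_sum /=.
under eq_bigr => i _ do rewrite mulmx_sumr raddf_sum /=.
rewrite exchange_big /=; apply: eq_bigr => j _; rewrite mxE mulr_suml.
apply: eq_bigr => i _; rewrite !mxE -scalemxAl -scalemxAr !mxtraceZ.
rewrite (_ : \tr (_ *m _) = \tr (C i *m C j)); first by ring.
by rewrite -!mulmxA (mulmxA A^T A) hA mul1mx mxtrace_mulC -!mulmxA hA mulmx1.
Qed.

Lemma einstein_act A phi C a b : A *m A^T = 1%:M -> phi *m phi^T = 1%:M ->
  einstein C a b -> einstein (act A phi C) a b.
Proof.
move=> hA hphi [h1 h2]; have hA' := mulmx1C hA; have hp := mulmx1C hphi.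
split; first by rewrite sumsq_act // h1 mul_mx_scalar -scalemxAl hA scalemx1.
by rewrite gram_act // h2 mul_mx_scalar -scalemxAl hp scalemx1.
Qed.

Lemma ssq_ge0 C : 0 <= ssq C.
Proof. by apply: sumr_ge0 => l _; exact: tr_mul_trmx_ge0. Qed.

Lemma sqr_entry_le_ssq C l i j : C l i j ^+ 2 <= ssq C.
Proof.
apply: le_trans (sqr_entry_le_tr _ _ _) _; rewrite /ssq (bigD1 l) //= lerDl.
by apply: sumr_ge0 => k _; exact: tr_mul_trmx_ge0.
Qed.

Lemma ssq_act A phi C : ssq (act A phi C) =
  \sum_k \sum_j (phi *m phi^T) k j * \tr (A^T *m A *m C k *m (A^T *m A) *m (C j)^T).
Proof.
rewrite /ssq /act.
under eq_bigr => l _ do rewrite mulmx_suml raddf_sum /=.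
rewrite exchange_big /=; apply: eq_bigr => k _.
under eq_bigr => l _ do rewrite linear_sum mulmx_sumr raddf_sum /=.
rewrite exchange_big /=; apply: eq_bigr => j _.
rewrite mxE mulr_suml; apply: eq_bigr => l _.
rewrite linearZ /= -scalemxAl -scalemxAr !mxtraceZ mulrA mxE; congr (_ * _).
by rewrite !trmx_mul trmxK !mulmxA mxtrace_mulC !mulmxA.
Qed.

(** The norm sees [A] only through A^T A and [phi] only through phi phi^T. In the diagonal case each
    entry of [C] is a weight vector, which lets growth be read off entry by entry. *)
Lemma ssq_act_diag A phi C s t :
  A^T *m A = diag_mx s -> phi *m phi^T = diag_mx t ->
  ssq (act A phi C) = \sum_l \sum_i \sum_j s 0 i * s 0 j * t 0 l * C l i j ^+ 2.
Proof.
move=> hA hphi; rewrite ssq_act hA hphi; apply: eq_bigr => l _.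
rewrite (bigD1 l) //= big1 ?addr0; last first.
  by move=> j jl; rewrite mxE eq_sym (negPf jl) mulr0n mul0r.
rewrite tr_mul_trmx_sum mulr_sumr; apply: eq_bigr => i _.
rewrite mulr_sumr; apply: eq_bigr => j _.
by rewrite !mul_mx_diag !mul_diag_mx !mxE eqxx mulr1n; ring.
Qed.

Lemma orbit_refl C : orbit C C.
Proof. by exists 1%:M, 1%:M; rewrite !det1 act1. Qed.

Lemma det1_unitmx p (A : 'M[R]_p) : \det A = 1 -> A \in unitmx.
Proof. by rewrite unitmxE => ->; rewrite unitr1. Qed.

End Tuples.

(* Compactness arguments take limits along this fixed nonprincipal ultrafilter:
   every bounded real sequence converges, so no subsequences are needed. *)
Definition omega : set_system nat :=
  projT1 (cid (ultraFilterLemma eventually_filter)).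

#[global] Instance omega_ultra : UltraFilter omega.
Proof. by rewrite /omega; case: cid => G [? ?]. Qed.

#[global] Instance omega_proper : ProperFilter omega.
Proof. exact: ultra_proper. Qed.

(** * Limits along the ultrafilter and existence of minimisers *)

Section Ultralimits.
Variable R : realType.

Lemma eventually_omega : omega `=>` \oo.
Proof. by rewrite /omega; case: cid => G [? ?]. Qed.

Lemma ucvg_seq (T : topologicalType) (u : nat -> T) (l : T) :
  u @ \oo --> l -> u @ omega --> l.
Proof. by move=> h; apply: cvg_trans h; exact: cvg_app eventually_omega. Qed.

(** Compactness of [-M, M] yields a cluster point of the image of [omega], and an ultrafilter
    converges to each of its cluster points. *)
Lemma ucvg_bounded (u : nat -> R) M : (forall k, `|u k| <= M) ->
  exists l : R, u @ omega --> l.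
Proof.
move=> uM; have [|l [_ ul]] := @segment_compact R (- M) M (u @ omega)
    (fmap_proper_filter u omega_proper).
  rewrite /nbhs /=; apply: (@filterE _ omega) => k /=.
  by rewrite in_itv /= -ler_norml.
exists l => U lU; have [//|nU] := in_ultra_setVsetC (u @^-1` U) omega_ultra.
by have [x [/= ? ?]] := ul (~` U) U nU lU.
Qed.

Lemma ucvg_le (u v : nat -> R) (l l' : R) : (forall k, u k <= v k) ->
  u @ omega --> l -> v @ omega --> l' -> l <= l'.
Proof. by move=> uv ul vl; apply: (ler_cvg_to ul vl); exact: filterE. Qed.

Lemma ucvg_uniq (u : nat -> R) (l l' : R) : u @ omega --> l -> u @ omega --> l' -> l = l'.
Proof. exact: cvg_unique. Qed.

Lemma ucvg_sum (I : Type) (r : seq I) (P : pred I) (u : I -> nat -> R) (l : I -> R) :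
  (forall i, P i -> u i @ omega --> l i) ->
  (fun k => \sum_(i <- r | P i) u i k) @ omega --> \sum_(i <- r | P i) l i.
Proof.
move=> h; elim: r => [|i r IH].
  rewrite big_nil; under eq_fun => k do rewrite big_nil.
  exact: cvg_cst.
rewrite big_cons; under eq_fun => k do rewrite big_cons.
by case: ifPn => // Pi; apply: cvgD => //; exact: h.
Qed.

Lemma ucvg_prod (I : Type) (r : seq I) (P : pred I) (u : I -> nat -> R) (l : I -> R) :
  (forall i, P i -> u i @ omega --> l i) ->
  (fun k => \prod_(i <- r | P i) u i k) @ omega --> \prod_(i <- r | P i) l i.
Proof.
move=> h; elim: r => [|i r IH].
  rewrite big_nil; under eq_fun => k do rewrite big_nil.
  exact: cvg_cst.
rewrite big_cons; under eq_fun => k do rewrite big_cons.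
by case: ifPn => // Pi; apply: cvgM => //; exact: h.
Qed.

Definition mcvg p q (A : nat -> 'M[R]_(p, q)) (B : 'M[R]_(p, q)) :=
  forall i j, (fun k => A k i j) @ omega --> B i j.

Lemma mcvg_cst p q (B : 'M[R]_(p, q)) : mcvg (fun=> B) B.
Proof. by move=> i j; exact: cvg_cst. Qed.

Lemma mcvg_uniq p q (A : nat -> 'M[R]_(p, q)) B B' : mcvg A B -> mcvg A B' -> B = B'.
Proof. by move=> h h'; apply/matrixP => i j; exact: ucvg_uniq (h i j) (h' i j). Qed.

Lemma mcvg_bounded p q (A : nat -> 'M[R]_(p, q)) M :
  (forall k i j, `|A k i j| <= M) -> exists B, mcvg A B.
Proof.
move=> h; pose f i j := cid (ucvg_bounded (fun k => h k i j)).
exists (\matrix_(i, j) projT1 (f i j)) => i j; rewrite mxE.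
exact: projT2 (f i j).
Qed.

Lemma mcvgM p q r (A : nat -> 'M[R]_(p, q)) (B : nat -> 'M[R]_(q, r)) A' B' :
  mcvg A A' -> mcvg B B' -> mcvg (fun k => A k *m B k) (A' *m B').
Proof.
move=> hA hB i j; rewrite mxE; under eq_fun => k do rewrite mxE.
by apply: ucvg_sum => l _; apply: cvgM.
Qed.

Lemma mcvgT p q (A : nat -> 'M[R]_(p, q)) A' :
  mcvg A A' -> mcvg (fun k => (A k)^T) A'^T.
Proof.
move=> hA i j; rewrite mxE; under eq_fun => k do rewrite mxE.
exact: hA.
Qed.

Lemma mcvgZ p q (u : nat -> R) (A : nat -> 'M[R]_(p, q)) (l : R) A' :
  u @ omega --> l -> mcvg A A' -> mcvg (fun k => u k *: A k) (l *: A').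
Proof.
move=> hu hA i j; rewrite mxE; under eq_fun => k do rewrite mxE.
by apply: cvgM.
Qed.

Lemma mcvg_sum p q (I : Type) (r : seq I) (P : pred I)
    (A : I -> nat -> 'M[R]_(p, q)) A' :
  (forall i, P i -> mcvg (A i) (A' i)) ->
  mcvg (fun k => \sum_(i <- r | P i) A i k) (\sum_(i <- r | P i) A' i).
Proof.
move=> h i j; rewrite summxE; under eq_fun => k do rewrite summxE.
by apply: ucvg_sum => l Pl; exact: h.
Qed.

Lemma ucvg_tr p (A : nat -> 'M[R]_p) A' :
  mcvg A A' -> (fun k => \tr (A k)) @ omega --> \tr A'.
Proof. by move=> h; apply: ucvg_sum => i _; exact: h. Qed.

Lemma ucvg_det p (A : nat -> 'M[R]_p) A' :
  mcvg A A' -> (fun k => \det (A k)) @ omega --> \det A'.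
Proof.
move=> h; apply: ucvg_sum => s _; apply: cvgM; first exact: cvg_cst.
by apply: ucvg_prod => i _; exact: h.
Qed.

Lemma mcvg_act m n (A : nat -> 'M[R]_m) (phi : nat -> 'M[R]_n) C A' phi' C' l :
  mcvg A A' -> mcvg phi phi' -> (forall j, mcvg (C^~ j) (C' j)) ->
  mcvg (fun k => act (A k) (phi k) (C k) l) (act A' phi' C' l).
Proof.
move=> hA hphi hC; apply: mcvg_sum => j _; apply: mcvgZ; first exact: hphi.
by apply: mcvgM; [apply: mcvgM|apply: mcvgT].
Qed.

Lemma ucvg_ssq m n (C : nat -> 'I_n -> 'M[R]_m) C' :
  (forall j, mcvg (C^~ j) (C' j)) -> (fun k => ssq (C k)) @ omega --> ssq C'.
Proof.
move=> hC; apply: ucvg_sum => j _; apply: ucvg_tr; apply: mcvgM => //.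
exact: mcvgT.
Qed.

(** A crude consequence of (|x| - 1)^2 >= 0 that turns bounds on squares into entrywise bounds
    without square roots. *)
Lemma normr_le_sqr1 (x M : R) : x ^+ 2 <= M -> `|x| <= M + 1.
Proof.
move=> h; have h2 : 0 <= (`|x| - 1) ^+ 2 := sqr_ge0 _.
have h3 : `|x| ^+ 2 = x ^+ 2 by rewrite real_normK // num_real.
have h4 : 0 <= x ^+ 2 := sqr_ge0 _.
have h5 : 0 <= `|x| := normr_ge0 _.
rewrite -h3 in h h4; nra.
Qed.

Lemma mcvg_bounded_tr p q (A : nat -> 'M[R]_(p, q)) M :
  (forall k, \tr (A k *m (A k)^T) <= M) -> exists B, mcvg A B.
Proof.
move=> h; apply: (@mcvg_bounded _ _ _ (M + 1)) => k i j.
by apply: normr_le_sqr1; apply: le_trans (sqr_entry_le_tr _ _ _) (h k).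
Qed.

Lemma tcvg_bounded m n (C : nat -> 'I_n -> 'M[R]_m) M :
  (forall k, ssq (C k) <= M) -> exists D, forall j, mcvg (C^~ j) (D j).
Proof.
move=> h; have b j : exists B, mcvg (C^~ j) B.
  apply: (@mcvg_bounded _ _ _ (M + 1)) => k p q.
  by apply: normr_le_sqr1; apply: le_trans (sqr_entry_le_ssq _ _ _ _) (h k).
by exists (fun j => projT1 (cid (b j))) => j; exact: projT2 (cid (b j)).
Qed.

(* A function bounded below attains its infimum as soon as ultralimits of
   sequences along which it is bounded do not increase it. *)
Lemma exists_minimizer T (F : T -> R) (x0 : T) : (forall x, 0 <= F x) ->
  (forall (x : nat -> T) (M l : R), (forall k, F (x k) <= M) -> F \o x @ omega --> l ->
     exists y, F y <= l) ->
  exists x, forall y, F x <= F y.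
Proof.
move=> F0 h; pose E := [set F x | x in setT].
have infE : has_inf E by split; [exists (F x0), x0|exists 0 => _ [x _ <-]].
have seq k : exists x, F x < inf E + k.+1%:R^-1.
  have k0 : 0 < k.+1%:R^-1 :> R by rewrite invr_gt0.
  by have [_ [x _ <-] hx] := inf_adherent k0 infE; exists x.
pose x k := projT1 (cid (seq k)).
have hx k : F (x k) < inf E + k.+1%:R^-1 := projT2 (cid (seq k)).
have lE y : inf E <= F y by apply: ge_inf; [case: infE|exists y].
have xE : F \o x @ omega --> inf E.
  apply: ucvg_seq; apply: (@squeeze_cvgr _ _ _ _ (fun=> inf E)
    (fun k => inf E + k.+1%:R^-1)).
  - by apply: nearW => k /=; rewrite lE ltW.
  - exact: cvg_cst.
  - rewrite -[X in _ --> X]addr0; apply: cvgD; first exact: cvg_cst.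
    exact: cvg_harmonic.
have [|y hy] := h x (inf E + 1) _ _ xE.
  move=> k; apply: ltW; apply: lt_le_trans (hx k) _.
  by rewrite lerD2l invf_le1 // ler1n.
by exists y => z; exact: le_trans hy (lE z).
Qed.

End Ultralimits.

(** * Diagonalisation of symmetric matrices and factorisation of positive definite ones *)

Section Spectral.
Variable R : realType.

Lemma quad_form_delta p (M : 'M[R]_p) i j t :
  let v := delta_mx 0 i + t *: delta_mx 0 j : 'rV[R]_p in
  (v *m M *m v^T) 0 0 = M i i + t * (M i j + M j i) + t ^+ 2 * M j j.
Proof.
have e k l : (delta_mx 0 k *m M *m (delta_mx 0 l)^T : 'M[R]_1) 0 0 = M k l.
  by rewrite -rowE trmx_delta -colE !mxE.
rewrite /= linearD /= linearZ /= !mulmxDl !mulmxDr -!scalemxAl -!scalemxAr.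
have D (X Y : 'M[R]_1) : (X + Y) 0 0 = X 0 0 + Y 0 0 by rewrite mxE.
have Z (c : R) (X : 'M[R]_1) : (c *: X) 0 0 = c * X 0 0 by rewrite mxE.
rewrite !(D, Z, e); ring.
Qed.

Lemma cubic_le0 (a b : R) : (forall t, a * t + b * t ^+ 2 - a * t ^+ 3 <= 0) -> a = 0.
Proof.
move=> h; apply/eqP/negPn/negP => a0.
have a2 : 0 < a ^+ 2 by rewrite exprn_even_gt0.
have b0 : 0 <= `|b| := normr_ge0 b.
have b1 : - `|b| <= b by rewrite lerNl -normrN ler_norm.
(* At t = e a the polynomial is a^2 e (1 + b e - a^2 e^2). Since e^2 <= e and e (|b| + a^2) = 1 - e,
   the bracket is at least e, hence positive. *)
pose e := (1 + `|b| + a ^+ 2)^-1.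
have k0 : 0 < 1 + `|b| + a ^+ 2 by lra.
have e0 : 0 < e by rewrite invr_gt0.
have ek : e * (1 + `|b| + a ^+ 2) = 1 by rewrite mulVf // gt_eqF.
have e1 : e <= 1 by nra.
have := h (e * a); rewrite leNgt => /negP; apply.
rewrite (_ : _ - _ = (a ^+ 2 * e) * (1 + b * e - a ^+ 2 * e ^+ 2)); last by ring.
apply: mulr_gt0; first exact: mulr_gt0.
have : e ^+ 2 <= e by rewrite expr2; nra.
by nra.
Qed.

Lemma tr_mulmx_rank1 p (M : 'M[R]_p) (v : 'rV[R]_p) :
  \tr (M *m (v^T *m v)) = (v *m M *m v^T) 0 0.
Proof. by rewrite mulmxA mxtrace_mulC mulmxA trace_mx11. Qed.

Lemma tr_reflection p (D B : 'M[R]_p) (v : 'rV[R]_p) (c : R) :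
  D^T = D -> B^T = B ->
  let H := 1%:M - c *: (v^T *m v) in
  \tr (D *m (H *m B *m H)) = \tr (D *m B) - 2 * c * (v *m (B *m D) *m v^T) 0 0
     + c ^+ 2 * ((v *m B *m v^T) 0 0 * (v *m D *m v^T) 0 0).
Proof.
move=> sD sB /=.
rewrite !mulmxBl !mulmxBr mul1mx !mulmx1 -!scalemxAl -!scalemxAr !raddfB /=.
rewrite !mxtraceZ.
have -> : \tr (D *m (v^T *m v *m B)) = (v *m (B *m D) *m v^T) 0 0.
  by rewrite (mulmxA D) mxtrace_mulC (mulmxA B) tr_mulmx_rank1.
have -> : \tr (D *m (B *m (v^T *m v))) = (v *m (B *m D) *m v^T) 0 0.
  rewrite (mulmxA D) tr_mulmx_rank1 -[in LHS](trmxK (_ *m _ *m _)) mxE.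
  by rewrite !trmx_mul trmxK sD sB !mulmxA.
have -> : \tr (D *m (v^T *m v *m B *m (v^T *m v))) =
    (v *m B *m v^T) 0 0 * (v *m D *m v^T) 0 0.
  rewrite (_ : _ *m _ *m _ = (v *m B *m v^T) 0 0 *: (v^T *m v)).
    by rewrite -scalemxAr mxtraceZ tr_mulmx_rank1.
  rewrite -!mulmxA (mulmxA v B) (mulmxA (v *m B)).
  by rewrite [X in _ *m (X *m _)]mx11_scalar mul_scalar_mx -scalemxAr !mulmxA.
ring.
Qed.

(** The Householder reflection along [v]: with c = 2 / |v|^2 the quadratic term c^2 |v|^2 cancels 2
    c. *)
Lemma reflection_orthogonal p (v : 'rV[R]_p) : (v *m v^T) 0 0 != 0 ->
  let H := 1%:M - (2 / (v *m v^T) 0 0) *: (v^T *m v) in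
  H^T = H /\ H *m H = 1%:M.
Proof.
move=> v0 /=; set c := 2 / _; split.
  by rewrite linearB /= trmx1 linearZ /= trmx_mul trmxK.
rewrite mulmxBl !mulmxBr !mul1mx mulmx1 -scalemxAl -scalemxAr.
have -> : v^T *m v *m (v^T *m v) = (v *m v^T) 0 0 *: (v^T *m v).
  rewrite -!mulmxA (mulmxA v) [X in _ *m (X *m _)]mx11_scalar.
  by rewrite mul_scalar_mx -scalemxAr.
rewrite !scalerA (_ : c * _ * _ = c + c); last by rewrite /c; field.
by rewrite scalerDl opprB addrK subrK.
Qed.

(* Minimising the distance from U A U^T to a diagonal matrix D with distinct
   entries diagonalises A: reflections in vectors e_i + t e_j detect the entry
   (i, j) of U A U^T to first order in t. *)
Lemma spectral p (A : 'M[R]_p) : A^T = A ->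
  exists (U : 'M[R]_p) (d : 'rV[R]_p),
    U *m U^T = 1%:M /\ A = U^T *m diag_mx d *m U.
Proof.
move=> sA; pose D : 'M[R]_p := diag_mx (\row_i (i : nat)%:R).
have sD : D^T = D by rewrite tr_diag_mx.
pose T := {U : 'M[R]_p | U *m U^T = 1%:M}.
pose F (U : T) := let E := sval U *m A *m (sval U)^T - D in \tr (E *m E^T).
have I1 : 1%:M *m 1%:M^T = 1%:M :> 'M[R]_p by rewrite trmx1 mulmx1.
have [||[U UU] Umin] := @exists_minimizer R T F (exist _ 1%:M I1).
- by move=> U; exact: tr_mul_trmx_ge0.
- move=> U M l _ Ul.
  have [k|V UV] := @mcvg_bounded_tr R _ _ (fun k => sval (U k)) p%:R.
    by rewrite (svalP (U k)) mxtrace1.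
  have VV : V *m V^T = 1%:M.
    apply: (mcvg_uniq (mcvgM UV (mcvgT UV))) => i j.
    under eq_fun => k do rewrite (svalP (U k)).
    exact: cvg_cst.
  exists (exist _ V VV); rewrite le_eqVlt; apply/orP; left; apply/eqP.
  apply: (ucvg_uniq _ Ul); rewrite /F /=; apply: ucvg_tr.
  have h : mcvg (fun k => sval (U k) *m A *m (sval (U k))^T - D) (V *m A *m V^T - D).
    move=> i j; rewrite mxE; under eq_fun => k do rewrite mxE.
    apply: cvgD; last exact: cvg_cst.
    by apply: mcvgM; [apply: mcvgM => //; exact: mcvg_cst|exact: mcvgT].
  by apply: mcvgM => //; exact: mcvgT.
have [B BE] : exists B, U *m A *m U^T = B by eexists.
have sB : B^T = B by rewrite -BE !trmx_mul trmxK sA mulmxA.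
(* For orthogonal symmetric H the norm of H B H is that of B, so only the cross term with [D]
   depends on H. *)
have trF H : H^T = H -> H *m H = 1%:M ->
    \tr ((H *m B *m H - D) *m (H *m B *m H - D)^T) =
    \tr (B *m B) - 2 * \tr (D *m (H *m B *m H)) + \tr (D *m D).
  move=> sH HH; rewrite linearB /= trmx_mul (trmx_mul H) sH sB sD mulmxBl !mulmxBr.
  rewrite (mulmxA H B) !raddfB /= [\tr (H *m B *m H *m D)]mxtrace_mulC.
  rewrite (_ : \tr (H *m B *m H *m _) = \tr (B *m B)); first by ring.
  rewrite -!mulmxA (mulmxA H H) HH mul1mx mxtrace_mulC -!mulmxA HH mulmx1.
  by [].
(* Comparing the minimiser U with H U gives tr (D H B H) <= tr (D B); [tr_reflection] with c = 2 /
   |v|^2 rewrites this as the inequality below. *)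
have key (v : 'rV[R]_p) : (v *m v^T) 0 0 != 0 ->
    (v *m B *m v^T) 0 0 * (v *m D *m v^T) 0 0 <=
    (v *m v^T) 0 0 * (v *m (B *m D) *m v^T) 0 0.
  move=> v0; have [sH HH] := reflection_orthogonal v0.
  set H := (X in X^T = _) in sH; rewrite -/H in HH.
  have HU : H *m U *m (H *m U)^T = 1%:M.
    by rewrite trmx_mul -!mulmxA (mulmxA U) UU mul1mx sH.
  have := Umin (exist _ (H *m U) HU); rewrite /F /=.
  have -> : H *m U *m A *m (H *m U)^T = H *m B *m H.
    by rewrite trmx_mul sH -BE !mulmxA.
  have e1 := trF _ (trmx1 _ _) (mulmx1 _); rewrite mul1mx mulmx1 in e1.
  rewrite BE e1 trF // tr_reflection // => h.
  have s0 : 0 < (v *m v^T) 0 0.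
    by rewrite lt_neqAle eq_sym v0 -trace_mx11 tr_mul_trmx_ge0.
  move: h; set s := (v *m v^T) 0 0; set x := (_ *m (B *m D) *m _) 0 0.
  set y := (X in _ ^+ 2 * X) => h.
  have h1 : (2 / s) ^+ 2 * y <= 2 * (2 / s) * x by lra.
  have h2 : 0 < s ^+ 2 / 4 by rewrite divr_gt0 // exprn_gt0.
  have sn : s != 0 by [].
  have ey : y = s ^+ 2 / 4 * ((2 / s) ^+ 2 * y) by field.
  have ex : s * x = s ^+ 2 / 4 * (2 * (2 / s) * x) by field.
  by change (y <= s * x); rewrite ey ex; exact: ler_wpM2l (ltW h2) _ _ h1.
have Bd i j : i != j -> B i j = 0.
  move=> ij; have ijF := negPf ij.
  have jiF : (j == i) = false by rewrite eq_sym.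
  have dij : (i : nat)%:R - (j : nat)%:R != 0 :> R.
    by rewrite subr_eq0 eqr_nat.
  have : ((i : nat)%:R - (j : nat)%:R) * B i j = 0.
    (* For v = e_i + t e_j the constant and quartic terms of [key] cancel. What remains is a t + b
       t^2 - a t^3 <= 0 with a = (i - j) B_ij and b = - (i - j) (B_ii - B_jj). *)
    apply: (@cubic_le0 _ (- ((i : nat)%:R - (j : nat)%:R) * (B i i - B j j))) => t.
    pose v : 'rV[R]_p := delta_mx 0 i + t *: delta_mx 0 j.
    have vv : (v *m v^T) 0 0 = 1 + t ^+ 2.
      rewrite -[v in v *m _]mulmx1 quad_form_delta !mxE !eqxx ijF jiF /=.
      by rewrite !addr0 mulr0 addr0 mulr1.
    have v0 : (v *m v^T) 0 0 != 0.
      by rewrite vv gt_eqF // ltr_pwDl // sqr_ge0.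
    have := key _ v0; rewrite vv !quad_form_delta.
    have Bji : B j i = B i j by rewrite -[in LHS]sB mxE.
    have BD k l : (B *m D) k l = B k l * (l : nat)%:R.
      by rewrite mul_mx_diag !mxE.
    rewrite !BD Bji /D !mxE !eqxx ijF jiF !mulr1n !mulr0n.
    by move=> h; nra.
  by move/eqP; rewrite mulf_eq0 (negPf dij) => /eqP.
exists U, (\row_i B i i); split=> //.
have -> : diag_mx (\row_i B i i) = B.
  apply/matrixP => i j; rewrite !mxE; case: eqVneq => [->|ij].
    by rewrite mulr1n.
  by rewrite (Bd _ _ ij) mulr0n.
have UU' := mulmx1C UU.
by rewrite -BE !mulmxA UU' mul1mx -mulmxA UU' mulmx1.
Qed.

(** [W] is U^T diag(sqrt d) from a spectral decomposition. Applied to a Gram matrix it provides an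
    orthonormal frame. *)
Lemma posdef_factor p (G : 'M[R]_p) : G^T = G ->
  (forall x : 'rV[R]_p, x != 0 -> 0 < (x *m G *m x^T) 0 0) ->
  exists2 W : 'M[R]_p, W \in unitmx & G = W *m W^T.
Proof.
move=> sG pG; have [U [d [UU Gd]]] := spectral sG.
have dpos i : 0 < d 0 i.
  have v0 : (delta_mx 0 i : 'rV[R]_p) *m U != 0.
    apply/eqP => /(congr1 (fun x : 'rV[R]_p => (x *m U^T) 0 i)).
    rewrite -mulmxA UU mulmx1 mul0mx !mxE !eqxx => /eqP.
    by rewrite oner_eq0.
  move: (pG _ v0).
  rewrite Gd trmx_mul !mulmxA -(mulmxA _ U U^T) UU mulmx1 -(mulmxA _ U U^T) UU mulmx1.
  by rewrite -rowE trmx_delta -colE !mxE eqxx mulr1n.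
pose s := \row_i Num.sqrt (d 0 i).
exists (U^T *m diag_mx s).
  have uU : U^T \in unitmx by rewrite unitmx_tr; case/mulmx1_unit: UU.
  rewrite unitmx_mul uU unitmxE det_diag unitfE prodf_seq_neq0.
  by apply/allP => i _ /=; rewrite mxE sqrtr_eq0 -ltNge.
rewrite trmx_mul trmxK tr_diag_mx !mulmxA -(mulmxA _ (diag_mx s) (diag_mx s)) mulmx_diag Gd.
do 2 congr (_ *m _); congr diag_mx; apply/rowP => i.
by rewrite !mxE -expr2 sqr_sqrtr // ltW.
Qed.

End Spectral.

(** * From the soliton equation to the Einstein condition *)

Section SolitonEinstein.
Variables (R : realType) (m n : nat).
Implicit Types (C : 'I_n -> 'M[R]_m).

Lemma sumsq_sym C : skew C -> (sumsq C)^T = sumsq C.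
Proof.
move=> sC; rewrite /sumsq linear_sum; apply: eq_bigr => l _ /=.
by rewrite trmx_mul sC mulNmx mulmxN opprK.
Qed.

Lemma gram_sym C : (gram C)^T = gram C.
Proof. by apply/matrixP => k l; rewrite !mxE mxtrace_mulC. Qed.

Lemma pencil_delta C l : pencil C (delta_mx 0 l) = C l.
Proof.
rewrite /pencil (bigD1 l) //= mxE !eqxx scale1r big1 ?addr0 // => k kl.
by rewrite mxE (negPf kl) scale0r.
Qed.

Lemma nonsing_unitmx C l : nonsing C -> C l \in unitmx.
Proof.
move=> nC; rewrite -pencil_delta; apply: nC; apply/eqP => /rowP/(_ l).
by rewrite !mxE !eqxx => /eqP; rewrite oner_eq0.
Qed.

Lemma unitmx_neq0 (A : 'M[R]_m) : (0 < m)%N -> A \in unitmx -> A != 0.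
Proof.
move=> m0 uA; apply/eqP => A0; have := mulmxV uA.
rewrite A0 mul0mx => /matrixP/(_ (Ordinal m0) (Ordinal m0)) /eqP.
by rewrite !mxE eqxx eq_sym oner_eq0.
Qed.

Lemma ssq_gt0 C : (0 < m)%N -> (0 < n)%N -> nonsing C -> 0 < ssq C.
Proof.
move=> m0 n0 nC; pose l0 := Ordinal n0.
rewrite lt_neqAle ssq_ge0 andbT eq_sym.
apply: contraTneq (nonsing_unitmx l0 nC) => ssq0; apply/negP => /(unitmx_neq0 m0).
case/eqP; apply/matrixP => i j; rewrite mxE; apply/eqP.
by rewrite -sqrf_eq0 eq_le sqr_ge0 -ssq0 sqr_entry_le_ssq.
Qed.

(** Here b = tr (C_l^2) = - |C_l|^2 is nonzero because C_l is invertible, and the trace of [sumsq C]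
    gives m a = n b. *)
Lemma einstein_neg C a b : (0 < m)%N -> (0 < n)%N -> skew C -> nonsing C ->
  einstein C a b -> a < 0 /\ b < 0.
Proof.
move=> m0 n0 sC nC [ha hb]; pose l0 := Ordinal n0.
have trN l : \tr (C l *m C l) = - \tr (C l *m (C l)^T).
  by rewrite sC mulmxN raddfN opprK.
have b0 : b < 0.
  have <- : gram C l0 l0 = b by rewrite hb mxE eqxx.
  rewrite mxE trN oppr_lt0 lt_neqAle tr_mul_trmx_ge0 andbT eq_sym.
  apply: contraTneq (nonsing_unitmx l0 nC) => /tr_mul_trmx_eq0 ->.
  by apply/negP => /(unitmx_neq0 m0); rewrite eqxx.
split=> //.
have : \tr (sumsq C) = b *+ n.
  rewrite /sumsq raddf_sum /= -[in RHS](card_ord n) -sumr_const.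
  apply: eq_bigr => l _; transitivity (gram C l l); first by rewrite mxE.
  by rewrite hb mxE eqxx.
rewrite ha mxtrace_scalar => e.
by rewrite -(pmulrn_llt0 _ m0) e pmulrn_llt0.
Qed.

Lemma einstein_soliton C a b : einstein C a b -> soliton C (a + b / 4).
Proof.
move=> [ha hb] l; rewrite ha hb mul_scalar_mx mul_mx_scalar (bigD1 l) //=.
rewrite big1 => [|k kl]; last by rewrite mxE (negPf kl) scale0r.
by rewrite mxE eqxx mulr1n addr0 -scalerDl !scalerA -scalerDl; congr (_ *: _); field.
Qed.

(* The soliton equation says J(z B) = M J(z) + J(z) M for all z.  On an
   eigenvector z of B, taking the trace against J(z)^-1 shows that the
   eigenvalue is 2 tr(M) / m, so B is scalar; then M minus a scalar anticommutes
   with all C_l and is therefore orthogonal to itself. *)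
Lemma soliton_einstein C c : (0 < m)%N -> (0 < n)%N -> skew C -> nonsing C ->
  soliton C c -> exists a b, [/\ a < 0, b < 0 & einstein C a b].
Proof.
move=> m0 n0 sC nC sol; pose l0 := Ordinal n0.
(* Shifting by c absorbs the right-hand side: the equation becomes M C_l + C_l M = -1/2 sum_k G_kl
   C_k. *)
pose M := sumsq C - c%:M.
have MC l : M *m C l + C l *m M = - 2^-1 *: \sum_k gram C k l *: C k.
  have := sol l; rewrite /M mulmxBl mulmxBr mul_scalar_mx mul_mx_scalar.
  set X := sumsq C *m C l; set Y := C l *m sumsq C; set Z := \sum_k _ => h.
  rewrite addrACA -opprD -scalerDl; have -> : (c + c) *: C l = 2 *: (c *: C l).
    by rewrite scalerA; congr (_ *: _); ring.
  rewrite -h scalerDr !scalerA divff // scale1r opprD addNKr ?addrA ?subrr ?sub0r.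
  by rewrite -scaleNr; congr (_ *: _); field.
have MJ z : M *m pencil C z + pencil C z *m M = - 2^-1 *: pencil C (z *m gram C).
  rewrite /pencil mulmx_sumr mulmx_suml -big_split /=.
  under eq_bigr => l _ do rewrite -scalemxAl -scalemxAr -scalerDr MC scalerA mulrC -scalerA.
  rewrite -scaler_sumr; congr (_ *: _).
  transitivity (\sum_l \sum_k z 0 l *: (gram C k l *: C k)).
    by apply: eq_bigr => l _; exact: scaler_sumr.
  rewrite exchange_big /=; apply: eq_bigr => k _; rewrite mxE scaler_suml.
  by apply: eq_bigr => l _; rewrite scalerA -[in LHS]gram_sym [_^T _ _]mxE.
have [U [d [UU Gd]]] := spectral (gram_sym C).
have dE i : d 0 i = - 4 * \tr M / m%:R.
  have zE : row i U *m gram C = d 0 i *: row i U.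
    rewrite Gd !mulmxA -row_mul UU rowE mulmx1 -rowE.
    apply/rowP => j; rewrite mxE (bigD1 i) //= big1 ?addr0.
      by rewrite !mxE eqxx mulr1n.
    by move=> k ki; rewrite !mxE eq_sym (negPf ki) mulr0n mul0r.
  have u0 : pencil C (row i U) \in unitmx.
    apply: nC; apply/eqP => h.
    have : row i U *m U^T = 0 by rewrite h mul0mx.
    rewrite -row_mul UU => /rowP/(_ i); rewrite !mxE eqxx => /eqP.
    by rewrite oner_eq0.
  have := MJ (row i U); rewrite zE => h.
  have pZ : pencil C (d 0 i *: row i U) = d 0 i *: pencil C (row i U).
    by rewrite /pencil scaler_sumr; apply: eq_bigr => k _; rewrite mxE scalerA.
  move: h; rewrite pZ => /(congr1 (fun X => \tr (X *m invmx (pencil C (row i U))))).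
  rewrite mulmxDl raddfD /= -mulmxA mulmxV // mulmx1.
  rewrite mxtrace_mulC mulmxA mulVmx // mul1mx -!scalemxAl mulmxV //.
  rewrite !mxtraceZ mxtrace1 => h.
  have mn : m%:R != 0 :> R by rewrite pnatr_eq0 -lt0n.
  apply: (mulIf mn); rewrite mulfVK //; lra.
have [b bE] : exists b, - 4 * \tr M / m%:R = b by eexists.
have GB : gram C = b%:M.
  rewrite Gd (_ : d = const_mx b); last by apply/rowP => i; rewrite dE bE mxE.
  by rewrite diag_const_mx mul_mx_scalar -scalemxAl (mulmx1C UU) scalemx1.
(* With G = b the equation reads M C_l + C_l M = -(b/2) C_l, so adding b/4 to M makes it anticommute
   with every C_l. *)
pose A := M + (b / 4)%:M.
have AC l : A *m C l = - (C l *m A).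
  have := MC l; rewrite GB (bigD1 l) //= big1; last first.
    by move=> k kl; rewrite mxE (negPf kl) scale0r.
  rewrite mxE eqxx mulr1n addr0 scalerA => h; apply/eqP; rewrite -addr_eq0.
  rewrite /A mulmxDl mulmxDr mul_scalar_mx mul_mx_scalar addrACA h -scalerDl.
  rewrite -scalerDl; have -> : - 2^-1 * b + (b / 4 + b / 4) = 0 by field.
  by rewrite scale0r.
have uC := nonsing_unitmx l0 nC.
have trA : \tr A = 0.
  have : \tr A = - \tr A.
    rewrite -[A in LHS]mulmx1 -(mulmxV uC) mulmxA AC mulNmx raddfN /=.
    by rewrite mxtrace_mulC mulmxA mulVmx // mul1mx.
  by move=> h; lra.
have trAS : \tr (A *m sumsq C) = 0.
  rewrite /sumsq mulmx_sumr raddf_sum /= big1 // => l _.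
  have : \tr (A *m (C l *m C l)) = - \tr (A *m (C l *m C l)).
    rewrite [in LHS]mulmxA AC mulNmx raddfN /=; congr (- _).
    by rewrite [LHS]mxtrace_mulC [in LHS]mulmxA mxtrace_mulC.
  by move=> h; lra.
have sA : A^T = A.
  by rewrite /A /M linearD /= linearB /= !tr_scalar_mx sumsq_sym.
(* [A] differs from [sumsq C] by a scalar, so tr (A A^T) is tr (A S) plus a multiple of tr A, and
   both vanish. *)
have A0 : A = 0.
  apply: tr_mul_trmx_eq0; rewrite sA -{2}[A]/(M + _) /M -addrA mulmxDr raddfD /=.
  by rewrite trAS add0r -raddfN -raddfD mul_mx_scalar mxtraceZ trA mulr0.
have SE : sumsq C = (c - b / 4)%:M.
  move: A0; rewrite /A /M -addrA => /eqP; rewrite addr_eq0 => /eqP ->.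
  by rewrite -raddfN -raddfD -raddfN; congr (_%:M); ring.
have E : einstein C (c - b / 4) b by [].
exists (c - b / 4), b; split=> //; by case: (einstein_neg m0 n0 sC nC E).
Qed.

End SolitonEinstein.

(** * Minimal vectors of closed orbits *)

Section ClosedEinstein.
Variables (R : realType).

(** Closedness phrased with ultralimits of tuples, the form in which compactness is used;
    [closed_SL_orbit] relates it to the topology of [Vnm]. *)
Definition uclosed m n (S : set ('I_n -> 'M[R]_m)) :=
  forall (D : nat -> 'I_n -> 'M[R]_m) E, (forall k, S (D k)) ->
    (forall l, mcvg (D^~ l) (E l)) -> S E.

(** Two block triangular factorisations of one bordered matrix, as in the matrix determinant lemma.
    It puts 1 + t N in SL for the square-zero N = v^T w. *)
Lemma det_rank1_perturbation p (v w : 'rV[R]_p) : w *m v^T = 0 ->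
  \det (1%:M + v^T *m w) = 1.
Proof.
move=> wv.
have e1 : block_mx 1%:M (- w) v^T 1%:M =
    block_mx 1%:M 0 v^T 1%:M *m block_mx 1%:M (- w) 0 (1%:M + v^T *m w).
  rewrite mulmx_block !mul1mx !mulmx1 ?mul0mx ?mulmx0 ?addr0.
  by rewrite mulmxN addrC addrK.
have e2 : block_mx 1%:M (- w) v^T 1%:M =
    block_mx 1%:M (- w) 0 1%:M *m block_mx 1%:M 0 v^T 1%:M.
  by rewrite mulmx_block !mul1mx !mulmx1 ?mul0mx ?mulmx0 ?addr0 mulNmx wv oppr0 addr0 !add0r.
have := congr1 determinant e1; rewrite e2 !det_mulmx !det_lblock !det_ublock.
by rewrite !det1 !mul1r => <-.
Qed.

(** The pairs (e_j, e_i) remove the off-diagonal entries, and the pairs e_i + e_0, e_i - e_0 then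
    equate the diagonal ones. *)
Lemma scalar_of_orthogonal p (P : 'M[R]_p) : (0 < p)%N -> P^T = P ->
  (forall v w : 'rV[R]_p, w *m v^T = 0 -> (w *m P *m v^T) 0 0 = 0) ->
  exists a, P = a%:M.
Proof.
move=> p0 sP h; pose i0 := Ordinal p0; exists (P i0 i0).
have dd i j (Q : 'M[R]_p) :
    (delta_mx 0 i : 'rV[R]_p) *m Q *m (delta_mx 0 j : 'rV[R]_p)^T = (Q i j)%:M.
  by apply/matrixP => k l; rewrite -rowE trmx_delta -colE !mxE !ord1 eqxx mulr1n.
have off i j : i != j -> P i j = 0.
  move=> ij; have := h (delta_mx 0 j) (delta_mx 0 i).
  rewrite dd mxE eqxx mulr1n; apply.
  rewrite -[delta_mx 0 i]mulmx1 dd mxE (negPf ij); exact: raddf0.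
apply/matrixP => i j; rewrite mxE; case: eqVneq => [<-{j}|/off //].
case: (eqVneq i i0) => [->|ii0]; first by rewrite mulr1n.
pose v : 'rV[R]_p := delta_mx 0 i + delta_mx 0 i0.
pose w : 'rV[R]_p := delta_mx 0 i - delta_mx 0 i0.
have q (Q : 'M[R]_p) : w *m Q *m v^T = (Q i i + Q i i0 - Q i0 i - Q i0 i0)%:M.
  rewrite /v linearD /= /w !mulmxBl !mulmxDr !dd opprD.
  by rewrite -opprD -!raddfD -raddfB opprD addrA.
have i0i : i0 != i by rewrite eq_sym.
have := h v w; rewrite q (off _ _ ii0) (off _ _ i0i).
rewrite mxE eqxx !mulr1n subr0 addr0 => H; apply/eqP; rewrite -subr_eq0.
apply/eqP/H; rewrite -[w]mulmx1 q !mxE !eqxx (negPf i0i) (negPf ii0).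
by rewrite addr0 subr0 subrr raddf0.
Qed.

Lemma quartic_ge0 (a b c d : R) :
  (forall t, 0 <= a * t + b * t ^+ 2 + c * t ^+ 3 + d * t ^+ 4) -> a = 0.
Proof.
move=> h; apply/eqP/negPn/negP => a0.
have a2 : 0 < a ^+ 2 by rewrite exprn_even_gt0.
set K := `|b| + `|c| * `|a| + `|d| * a ^+ 2.
have K0 : 0 <= K by rewrite !addr_ge0 // mulr_ge0 // sqr_ge0.
(* At t = - e a the polynomial is - a^2 e (1 - e r) with r <= K because e <= 1; as e K = 1 - e < 1,
   this is negative. *)
pose e := (1 + K)^-1.
have k0 : 0 < 1 + K by lra.
have e0 : 0 < e by rewrite invr_gt0.
have ek : e * (1 + K) = 1 by rewrite mulVf // gt_eqF.
have e1 : e <= 1 by nra.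
have := h (- (e * a)); rewrite leNgt => /negP; apply.
rewrite (_ : _ + _ = - (a ^+ 2 * e) *
  (1 - e * (b - (c * a) * e + (d * a ^+ 2) * e ^+ 2))); last by ring.
rewrite mulNr oppr_lt0; apply: mulr_gt0; first exact: mulr_gt0.
have hc : - (c * a) * e <= `|c| * `|a|.
  have : - (c * a) <= `|c| * `|a| by rewrite -normrM -normrN ler_norm.
  have : 0 <= `|c| * `|a| by rewrite mulr_ge0.
  by nra.
have hd : (d * a ^+ 2) * e ^+ 2 <= `|d| * a ^+ 2.
  have h1 : d * a ^+ 2 <= `|d| * a ^+ 2 by rewrite ler_pM2r // ler_norm.
  have h2 : 0 <= `|d| * a ^+ 2 by rewrite mulr_ge0 // ltW.
  have h3 : e ^+ 2 <= 1 by rewrite expr_le1 // ltW.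
  have h4 : 0 <= e ^+ 2 by exact: sqr_ge0.
  by nra.
have := ler_norm b; rewrite /K in ek * => hb; nra.
Qed.

Variables m n : nat.
Implicit Types (C D X Y : 'I_n -> 'M[R]_m).

Definition tdot C D := \sum_l \tr (C l *m (D l)^T).

Lemma tdotC C D : tdot C D = tdot D C.
Proof. by apply: eq_bigr => l _; rewrite -mxtrace_tr trmx_mul trmxK. Qed.

Lemma tdotDl C D X : tdot (fun l => C l + D l) X = tdot C X + tdot D X.
Proof.
by rewrite -big_split; apply: eq_bigr => l _ /=; rewrite mulmxDl raddfD.
Qed.

Lemma tdotZl (t : R) C X : tdot (fun l => t *: C l) X = t * tdot C X.
Proof.
by rewrite /tdot mulr_sumr; apply: eq_bigr => l _; rewrite -scalemxAl mxtraceZ.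
Qed.

(** The curve has a quadratic term because (1 + t N) D (1 + t N)^T is quadratic in t; only the
    linear coefficient of its norm has to be explicit. *)
Lemma ssq_quad D X Y : exists b c d, forall t,
  ssq (fun l => D l + t *: X l + t ^+ 2 *: Y l) =
  ssq D + 2 * tdot X D * t + b * t ^+ 2 + c * t ^+ 3 + d * t ^+ 4.
Proof.
exists (2 * tdot Y D + tdot X X), (2 * tdot Y X), (tdot Y Y) => t.
rewrite -[LHS]/(tdot _ _) !tdotDl !tdotZl.
rewrite ![tdot _ (fun l => _ + _ + _)]tdotC !tdotDl !tdotZl.
rewrite [tdot D X]tdotC [tdot D Y]tdotC [tdot X Y]tdotC -[ssq D]/(tdot D D).
ring.
Qed.

Lemma min_first_variation D X Y :
  (forall t, ssq D <= ssq (fun l => D l + t *: X l + t ^+ 2 *: Y l)) ->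
  tdot X D = 0.
Proof.
move=> h; have [b [c [d e]]] := ssq_quad D X Y.
have : 2 * tdot X D = 0.
  by apply: (@quartic_ge0 _ b c d) => t; have := h t; rewrite e; lra.
by move=> h2; lra.
Qed.

(** Square-zero matrices N = v^T w are sufficient test directions: the first variations along them
    are -2 w S v^T and - w G v^T, and their vanishing is the hypothesis of
    [scalar_of_orthogonal]. *)
Lemma minimal_einstein D : (0 < m)%N -> (0 < n)%N -> skew D ->
  (forall A phi, \det A = 1 -> \det phi = 1 -> ssq D <= ssq (act A phi D)) ->
  exists a b, einstein D a b.
Proof.
move=> m0 n0 sD h.
have detZ p (v w : 'rV[R]_p) t : w *m v^T = 0 -> \det (1%:M + t *: (v^T *m w)) = 1.
  move=> wv; have := @det_rank1_perturbation _ (t *: v) w.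
  by rewrite linearZ /= -scalemxAr wv scaler0 -scalemxAl; exact.
have [|a ha] := scalar_of_orthogonal m0 (sumsq_sym sD).
  move=> v w wv; set N := v^T *m w.
  have : tdot (fun l => N *m D l + D l *m N^T) D = 0.
    apply: (@min_first_variation _ _ (fun l => N *m D l *m N^T)) => t.
    apply: (le_trans (h _ _ (detZ _ _ _ t wv) (det1 _ _))).
    rewrite le_eqVlt; apply/orP; left; apply/eqP; congr ssq.
    apply/funext => l; rewrite /act (bigD1 l) //= big1 ?addr0; last first.
      by move=> k kl; rewrite mxE (negPf kl) scale0r.
    rewrite mxE eqxx scale1r linearD /= trmx1 linearZ /= mulmxDl !mulmxDr.
    rewrite mul1mx !mulmx1 mulmxDl -!scalemxAl -!scalemxAr scalerDr scalerA -expr2.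
    by rewrite -/N !addrA.
  rewrite /tdot (_ : \sum_l _ = - 2 * (w *m sumsq D *m v^T) 0 0).
    by move=> e; lra.
  rewrite -trace_mx11 /sumsq mulmx_sumr mulmx_suml raddf_sum mulr_sumr /=.
  apply: eq_bigr => l _; rewrite mulmxDl raddfD /=.
  have e1 : \tr (N *m D l *m (D l)^T) = - \tr (w *m (D l *m D l) *m v^T).
    by rewrite sD mulmxN raddfN /= /N -!mulmxA mxtrace_mulC !mulmxA.
  have e2 : \tr (D l *m N^T *m (D l)^T) = \tr (N *m D l *m (D l)^T).
    rewrite -mxtrace_tr trmx_mul (trmx_mul (D l)) !trmxK mxtrace_mulC -!mulmxA.
    by rewrite sD mulNmx (mulmxN (D l)).
  by rewrite e2 e1; ring.
have [|b hb] := scalar_of_orthogonal n0 (gram_sym D).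
  move=> v w wv; set N := v^T *m w.
  have : tdot (fun l => \sum_k N k l *: D k) D = 0.
    apply: (@min_first_variation _ _ (fun l => 0)) => t.
    apply: (le_trans (h _ _ (det1 _ _) (detZ _ _ _ t wv))).
    rewrite le_eqVlt; apply/orP; left; apply/eqP; congr ssq.
    apply/funext => l; rewrite /act scaler0 addr0.
    under eq_bigr => k _ do rewrite trmx1 mul1mx mulmx1 mxE scalerDl.
    rewrite big_split /=; congr (_ + _).
      rewrite (bigD1 l) //= big1 ?addr0 ?mxE ?eqxx ?scale1r // => k kl.
      by rewrite mxE (negPf kl) scale0r.
    by rewrite scaler_sumr; apply: eq_bigr => k _; rewrite mxE scalerA.
  rewrite /tdot (_ : \sum_l _ = - (w *m gram D *m v^T) 0 0).
    by move=> e; lra.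
  rewrite -mulmxA mxE -sumrN; apply: eq_bigr => l _; rewrite mulmx_suml raddf_sum.
  rewrite mxE mulr_sumr -sumrN; apply: eq_bigr => k _ /=.
  rewrite sD mulmxN raddfN /= -scalemxAl mxtraceZ !mxE big_ord1 !mxE mxtrace_mulC.
  ring.
by exists a, b.
Qed.

Lemma closed_orbit_einstein C : (0 < m)%N -> (0 < n)%N -> skew C ->
  uclosed (orbit C) -> exists D a b, orbit C D /\ einstein D a b.
Proof.
move=> m0 n0 sC cC; pose T := {D | orbit C D}.
have [||[D CD] Dmin] := @exists_minimizer R T (fun x => ssq (sval x))
  (exist _ C (orbit_refl C)).
- by move=> D; exact: ssq_ge0.
- move=> D M l DM Dl; have [E DE] := tcvg_bounded DM.
  exists (exist _ E (cC _ _ (fun k => svalP (D k)) DE)) => /=.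
  by rewrite le_eqVlt (ucvg_uniq (ucvg_ssq DE) Dl) eqxx.
have sD : skew D by have [A [phi [_ _ ->]]] := CD; exact: skew_act.
have [|a [b ab]] := @minimal_einstein D m0 n0 sD.
  move=> A phi dA dphi; have [B [psi [dB dpsi e]]] := CD.
  apply: (Dmin (exist _ (act A phi D) _)).
  exists (A *m B), (psi *m phi); split; rewrite ?det_mulmx ?dA ?dB ?dphi ?dpsi ?mulr1 //.
  by rewrite -act_comp -e.
by exists D, a, b.
Qed.

End ClosedEinstein.

(** * Closedness of the orbits of Einstein tuples *)

Section EinsteinClosed.
Variable R : realType.

Lemma ucvg0_squeeze (u w : nat -> R) (M : R) : w @ omega --> (0 : R) ->
  (forall k, 0 <= u k <= M * w k) -> u @ omega --> (0 : R).
Proof.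
move=> w0 h; apply: (@squeeze_cvgr _ _ _ _ (fun=> 0) (fun k => M * w k)).
- exact: nearW.
- exact: cvg_cst.
- by rewrite -[X in _ --> X](mulr0 M); apply: cvgM => //; exact: cvg_cst.
Qed.

Lemma ln_le (x : R) : 0 < x -> ln x <= x.
Proof. by move=> x0; rewrite ltW // ln_sublinear. Qed.

Lemma ln_prod p (s : 'I_p -> R) : (forall i, 0 < s i) ->
  ln (\prod_i s i) = \sum_i ln (s i).
Proof.
move=> s0; have [//] : 0 < \prod_i s i /\ ln (\prod_i s i) = \sum_i ln (s i).
elim/big_rec2: _ => [|i y x _ [x0 xy]]; first by rewrite ln1.
by rewrite mulr_gt0 // lnM ?posrE // xy.
Qed.

(* Along a sequence of unimodular matrices X X^T of size S -> oo, the eigenvalues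
   s behave like S^y; those of exact order S (that is, e != 0) have y = 1. *)
Lemma eigenvalue_growth p (X : nat -> 'M[R]_p) (S : nat -> R) :
  (forall k, \det (X k) = 1) -> (forall k, \tr (X k *m (X k)^T) <= S k) ->
  (forall k, expR k.+1%:R <= S k) ->
  exists (u : nat -> 'M[R]_p) (s : nat -> 'rV[R]_p) (v : 'M[R]_p) (y e : 'rV[R]_p),
  [/\ [/\ forall k, u k *m (u k)^T = 1%:M,
      forall k, X k *m (X k)^T = (u k)^T *m diag_mx (s k) *m u k,
      mcvg u v & v *m v^T = 1%:M],
    [/\ forall k i, 0 < s k 0 i,
       forall i, (fun k => ln (s k 0 i) / ln (S k)) @ omega --> y 0 i &
       \sum_i y 0 i = 0],
    mcvg (fun k => (S k)^-1 *: (X k *m (X k)^T)) (v^T *m diag_mx e *m v) &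
    forall i, e 0 i * (1 - y 0 i) = 0].
Proof.
move=> dX XS expS.
have S0 k : 0 < S k by apply: lt_le_trans (expS k); exact: expR_gt0.
(* The exponential lower bound on S_k serves to make 1 / ln S_k tend to 0 by comparison with the
   harmonic sequence. *)
have lnS k : k.+1%:R <= ln (S k) by rewrite -[leLHS]expRK ler_ln ?posrE ?expR_gt0.
have lnS0 k : 0 < ln (S k) by apply: lt_le_trans (lnS k).
have w0 : (fun k => (ln (S k))^-1) @ omega --> (0 : R).
  apply: (@ucvg0_squeeze _ harmonic 1).
    by apply: ucvg_seq; exact: cvg_harmonic.
  by move=> k; rewrite invr_ge0 ltW //= mul1r lef_pV2 ?posrE.
have sym k : (X k *m (X k)^T)^T = X k *m (X k)^T by rewrite trmx_mul trmxK.
pose us k := cid (spectral (sym k)).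
pose u k := sval (us k).
pose s k := sval (cid (svalP (us k))).
have [uu uE] : (forall k, u k *m (u k)^T = 1%:M) /\
    (forall k, X k *m (X k)^T = (u k)^T *m diag_mx (s k) *m u k).
  by split=> k; have [] := svalP (cid (svalP (us k))).
have sE k : diag_mx (s k) = (u k *m X k) *m (u k *m X k)^T.
  rewrite trmx_mul !mulmxA -(mulmxA (u k)) uE !mulmxA uu mul1mx -mulmxA uu.
  by rewrite mulmx1.
have prods k : \prod_i s k 0 i = 1.
  rewrite -det_diag sE det_mulmx det_tr -expr2 det_mulmx dX mulr1.
  by have := congr1 determinant (uu k); rewrite det_mulmx det_tr det1 -expr2.
have spos k i : 0 < s k 0 i.
  have h : s k 0 i != 0.
    apply/eqP => h; have := prods k; rewrite (bigD1 i) //= h mul0r => /eqP.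
    by rewrite eq_sym oner_eq0.
  rewrite lt_neqAle eq_sym h /=.
  have -> : s k 0 i = diag_mx (s k) i i by rewrite mxE eqxx mulr1n.
  rewrite sE mxE; apply: sumr_ge0 => j _.
  by rewrite [X in _ * X]mxE -expr2 sqr_ge0.
have trs k : \tr (X k *m (X k)^T) = \sum_i s k 0 i.
  by rewrite uE mxtrace_mulC mulmxA uu mul1mx mxtrace_diag.
have sS k i : s k 0 i <= S k.
  apply: le_trans (XS k); rewrite trs (bigD1 i) //= lerDl.
  by apply: sumr_ge0 => j _; exact: ltW.
pose Y k : 'rV[R]_p := \row_i (ln (s k 0 i) / ln (S k)).
have Y1 k i : Y k 0 i <= 1.
  by rewrite mxE ler_pdivrMr // mul1r ler_ln ?posrE.
have sumY k : \sum_i Y k 0 i = 0.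
  under eq_bigr => i _ do rewrite mxE.
  by rewrite -mulr_suml -ln_prod // prods ln1 mul0r.
have [y Yy] : exists y, mcvg Y y.
  (* Each exponent is at most 1 and they sum to 0, so each is also at least -p. *)
  apply: (@mcvg_bounded _ _ _ _ (p%:R + 1)) => k i j; rewrite ord1 ler_norml.
  rewrite (le_trans (Y1 _ _)) ?lerDr // andbT.
  have : \sum_(j' | j' != j) Y k 0 j' <= p%:R.
    apply: le_trans (_ : \sum_(j' | j' != j) 1 <= _).
      by apply: ler_sum => j' _; exact: Y1.
    by rewrite sumr_const ler_nat -[leqRHS]card_ord max_card.
  by have := sumY k; rewrite (bigD1 j) //=; lra.
pose E k : 'rV[R]_p := \row_i (s k 0 i / S k).
have E01 k i : 0 < E k 0 i <= 1.
  by rewrite mxE divr_gt0 //= ler_pdivrMr // mul1r.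
have [e Ee] : exists e, mcvg E e.
  apply: (@mcvg_bounded _ _ _ _ 1) => k i j; rewrite ord1.
  by have /andP[h1 h2] := E01 k j; rewrite ger0_norm // ltW.
have [k|v uv] := @mcvg_bounded_tr _ _ _ u p%:R.
  by rewrite uu mxtrace1.
exists u, s, v, y, e; split.
- split=> //; apply: (mcvg_uniq (mcvgM uv (mcvgT uv))) => i j.
  under eq_fun => k do rewrite uu.
  exact: cvg_cst.
- split=> // [i|].
    by have := Yy 0 i; under eq_fun => k do rewrite mxE.
  apply: (ucvg_uniq (ucvg_sum (fun i _ => Yy 0 i))).
  under eq_fun => k do rewrite sumY.
  exact: cvg_cst.
- under eq_fun => k.
    rewrite (_ : _ *: _ = (u k)^T *m diag_mx (E k) *m u k); last first.
      rewrite uE scalemxAl scalemxAr; congr (_ *m _ *m _).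
      by apply/matrixP => i j; rewrite !mxE mulrC mulrnAl.
    over.
  apply: mcvgM => //; apply: mcvgM; first exact: mcvgT.
  move=> i j; rewrite mxE; under eq_fun => k do rewrite mxE.
  case: eqP => _; first exact: Ee.
  exact: cvg_cst.
- move=> i.
  have h : (fun k => E k 0 i * (1 - Y k 0 i)) @ omega --> e 0 i * (1 - y 0 i).
    by apply: cvgM => //; apply: cvgB => //; exact: cvg_cst.
  apply: (ucvg_uniq h); apply: (@ucvg0_squeeze _ _ 1 w0) => k.
  have /andP[e0 e1] := E01 k i.
  rewrite mulr_ge0 ?subr_ge0 ?(ltW e0) //= mul1r.
  (* Thus E (1 - Y) = - E ln E / ln S, where - E ln E <= 1 by ln (1/E) <= 1/E, so the limit is 0. *)
  have -> : 1 - Y k 0 i = - ln (E k 0 i) / ln (S k).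
    by rewrite !mxE ln_div ?posrE //; field; rewrite gt_eqF.
  rewrite mulrA ler_piMl // ?invr_ge0 ?(ltW (lnS0 k)) // -lnV ?posrE //.
  apply: le_trans (_ : E k 0 i * (E k 0 i)^-1 <= _).
    by rewrite ler_pM2l // ln_le // invr_gt0.
  by rewrite divff // gt_eqF.
Qed.

Variables m n : nat.
Implicit Types C D : 'I_n -> 'M[R]_m.

Definition is_rep C D (A : 'M[R]_m) (phi : 'M[R]_n) :=
  [/\ \det A = 1, \det phi = 1 & D = act A phi C].

Definition nrm (A : 'M[R]_m) (phi : 'M[R]_n) :=
  \tr (A *m A^T) + \tr (phi *m phi^T).

Lemma nrm_le A phi M : nrm A phi <= M ->
  \tr (A *m A^T) <= M /\ \tr (phi *m phi^T) <= M.
Proof.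
have := tr_mul_trmx_ge0 A; have := tr_mul_trmx_ge0 phi.
by rewrite /nrm => h1 h2 h; split; lra.
Qed.

Lemma is_rep_limit C (D : nat -> 'I_n -> 'M[R]_m) E A phi M :
  (forall k, is_rep C (D k) (A k) (phi k)) -> (forall k, nrm (A k) (phi k) <= M) ->
  (forall l, mcvg (D^~ l) (E l)) ->
  exists A' phi', [/\ is_rep C E A' phi', mcvg A A' & mcvg phi phi'].
Proof.
move=> rep bd DE.
have [k|A' AA] := @mcvg_bounded_tr _ _ _ A M; first by case: (nrm_le (bd k)).
have [k|phi' pp] := @mcvg_bounded_tr _ _ _ phi M; first by case: (nrm_le (bd k)).
exists A', phi'; split=> //; split.
- apply: (ucvg_uniq (ucvg_det AA)); under eq_fun => k do case: (rep k) => -> _ _.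
  exact: cvg_cst.
- apply: (ucvg_uniq (ucvg_det pp)); under eq_fun => k do case: (rep k) => _ -> _.
  exact: cvg_cst.
- apply/funext => l; apply: (mcvg_uniq (DE l)).
  have -> : D^~ l = fun k => act (A k) (phi k) C l.
    by apply/funext => k; case: (rep k) => _ _ ->.
  by apply: mcvg_act => // j; exact: mcvg_cst.
Qed.

(** The pairs carrying [C] to [D] form a closed set, and norm-bounded ones have ultralimits in
    it. *)
Lemma min_rep C D : orbit C D -> exists A phi, is_rep C D A phi /\
  forall B psi, is_rep C D B psi -> nrm A phi <= nrm B psi.
Proof.
move=> [A0 [phi0 rep0]].
pose T := {x : 'M[R]_m * 'M[R]_n | is_rep C D x.1 x.2}.
have [||[[A phi] rep] h] := @exists_minimizer R T
    (fun x => nrm (sval x).1 (sval x).2) (exist _ (A0, phi0) rep0).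
- by move=> x; rewrite addr_ge0 ?tr_mul_trmx_ge0.
- move=> x M l bd xl.
  have [A' [phi' [rep' AA pp]]] := is_rep_limit (fun k => svalP (x k)) bd
    (fun j => @mcvg_cst R _ _ (D j)).
  exists (exist _ (A', phi') rep') => /=.
  rewrite le_eqVlt; apply/orP; left; apply/eqP; apply: (ucvg_uniq _ xl).
  by apply: cvgD; apply: ucvg_tr; apply: mcvgM => //; exact: mcvgT.
by exists A, phi; split=> // B psi r; exact: (h (exist _ (B, psi) r)).
Qed.

(** By skewness the diagonal entries of [sumsq] and [gram] are, up to sign, sums of squares: row i
    over all slices has mass -a and each slice has mass -b. Trace-free weights therefore average to
    0, which is the vanishing of the moment map in these directions. *)
Lemma einstein_weight_sum C a b (y : 'rV[R]_m) (z : 'rV[R]_n) :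
  skew C -> einstein C a b ->
  \sum_l \sum_i \sum_j (y 0 i + y 0 j + z 0 l) * C l i j ^+ 2 =
  - (2 * a * (\sum_i y 0 i) + b * \sum_l z 0 l).
Proof.
move=> sC [ha hb].
have Cji l i j : C l j i = - C l i j.
  by have /matrixP/(_ i j) := sC l; rewrite !mxE.
have row i : \sum_l \sum_j C l i j ^+ 2 = - a.
  have : sumsq C i i = a by rewrite ha mxE eqxx mulr1n.
  rewrite summxE => <-; rewrite -sumrN; apply: eq_bigr => l _.
  by rewrite mxE -sumrN; apply: eq_bigr => j _; rewrite (Cji l i j); ring.
have slice l : \sum_i \sum_j C l i j ^+ 2 = - b.
  have : gram C l l = b by rewrite hb mxE eqxx mulr1n.
  rewrite mxE => <-; rewrite -sumrN; apply: eq_bigr => i _.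
  by rewrite mxE -sumrN; apply: eq_bigr => j _; rewrite (Cji l i j); ring.
have e1 : \sum_l \sum_i \sum_j y 0 i * C l i j ^+ 2 = - (a * \sum_i y 0 i).
  rewrite exchange_big mulr_sumr -sumrN; apply: eq_bigr => i _ /=.
  under eq_bigr => l _ do rewrite -mulr_sumr.
  by rewrite -mulr_sumr row; ring.
have e2 : \sum_l \sum_i \sum_j y 0 j * C l i j ^+ 2 = - (a * \sum_i y 0 i).
  rewrite -e1; apply: eq_bigr => l _; rewrite exchange_big; apply: eq_bigr => i _.
  by apply: eq_bigr => j _ /=; rewrite (Cji l i j) sqrrN.
have e3 : \sum_l \sum_i \sum_j z 0 l * C l i j ^+ 2 = - (b * \sum_l z 0 l).
  rewrite mulr_sumr -sumrN; apply: eq_bigr => l _.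
  under eq_bigr => i _ do rewrite -mulr_sumr.
  by rewrite -mulr_sumr slice; ring.
transitivity (\sum_l \sum_i \sum_j y 0 i * C l i j ^+ 2
  + \sum_l \sum_i \sum_j y 0 j * C l i j ^+ 2
  + \sum_l \sum_i \sum_j z 0 l * C l i j ^+ 2); last by rewrite e1 e2 e3; ring.
rewrite -!big_split; apply: eq_bigr => l _; rewrite -!big_split.
apply: eq_bigr => i _; rewrite -!big_split; apply: eq_bigr => j _ /=; ring.
Qed.

(** Each entry is multiplied by the exponential of minus its weight; either the weight or the entry
    is 0. *)
Lemma act_diag_fix C (y : 'rV[R]_m) (z : 'rV[R]_n) :
  (forall l i j, (y 0 i + y 0 j + z 0 l) * C l i j ^+ 2 = 0) ->
  act (diag_mx (\row_i expR (- y 0 i))) (diag_mx (\row_l expR (- z 0 l))) C = C.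
Proof.
move=> h; apply/funext => l; rewrite /act (bigD1 l) //= big1 ?addr0; last first.
  by move=> k kl; rewrite mxE (negPf kl) mulr0n scale0r.
apply/matrixP => i j; rewrite tr_diag_mx mul_mx_diag mul_diag_mx !mxE eqxx mulr1n.
have /eqP := h l i j; rewrite mulf_eq0 sqrf_eq0 => /orP[/eqP e|/eqP ->]; last by ring.
rewrite (_ : _ * _ = expR (- z 0 l - y 0 i - y 0 j) * C l i j).
  have -> : - z 0 l - y 0 i - y 0 j = - (y 0 i + y 0 j + z 0 l) by ring.
  by rewrite e oppr0 expR0 mul1r.
by rewrite !expRD; ring.
Qed.

Lemma tr_gram_mul p q (X : 'M[R]_(p, q)) (B : 'M[R]_p) :
  \tr (B *m X *m (B *m X)^T) = \tr (X *m X^T *m (B^T *m B)).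
Proof. by rewrite trmx_mul [RHS]mxtrace_mulC !mulmxA [LHS]mxtrace_mulC !mulmxA. Qed.

Lemma tr_gram_mulr p q (X : 'M[R]_(p, q)) (B : 'M[R]_q) :
  \tr (X *m B *m (X *m B)^T) = \tr (X^T *m X *m (B *m B^T)).
Proof. by rewrite trmx_mul !mulmxA [LHS]mxtrace_mulC !mulmxA. Qed.

Lemma sandwich_diag p (v : 'M[R]_p) (d : 'rV[R]_p) : v *m v^T = 1%:M ->
  let B := v^T *m diag_mx d *m v in
  B^T = B /\ B *m B = v^T *m diag_mx (\row_i d 0 i ^+ 2) *m v.
Proof.
move=> vv /=; split; first by rewrite !trmx_mul trmxK tr_diag_mx mulmxA.
rewrite !mulmxA -(mulmxA _ v v^T) vv mulmx1 -(mulmxA _ (diag_mx d) (diag_mx d)).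
by rewrite mulmx_diag; do 2 congr (_ *m _); congr diag_mx; apply/rowP => i; rewrite !mxE.
Qed.

Lemma tr_sandwich_diag p (v : 'M[R]_p) (e d : 'rV[R]_p) : v *m v^T = 1%:M ->
  \tr (v^T *m diag_mx e *m v *m (v^T *m diag_mx d *m v)) = \sum_i e 0 i * d 0 i.
Proof.
move=> vv; rewrite mxtrace_mulC !mulmxA -(mulmxA _ v v^T) vv mulmx1.
rewrite mxtrace_mulC !mulmxA vv mul1mx mulmx_diag mxtrace_diag.
by apply: eq_bigr => i _; rewrite mxE mulrC.
Qed.

(* If minimal representatives (A_k, phi_k) were unbounded, the eigenvalues of
   A_k^T A_k and phi_k phi_k^T would grow like S^y and S^z with S the size of
   (A_k, phi_k).  Boundedness of act A_k phi_k C and the Einstein condition force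
   (exp(-y), exp(-z)), in the limiting eigenbasis, to stabilise C.  Translating
   (A_k, phi_k) by it would divide the size by e^2 in the limit. *)
Lemma minimal_reps_bounded C a b M : skew C -> einstein C a b ->
  exists K, forall D A phi, is_rep C D A phi ->
    (forall B psi, is_rep C D B psi -> nrm A phi <= nrm B psi) ->
    ssq D <= M -> nrm A phi <= K.
Proof.
move=> sC eC; apply: contrapT => noK.
have bad (k : nat) : exists x : 'M[R]_m * 'M[R]_n,
    [/\ \det x.1 = 1, \det x.2 = 1, ssq (act x.1 x.2 C) <= M,
        forall B psi, is_rep C (act x.1 x.2 C) B psi -> nrm x.1 x.2 <= nrm B psi &
        expR k.+1%:R <= nrm x.1 x.2].
  apply: contrapT => nx; apply: noK; exists (expR k.+1%:R) => D A phi rep minA DM.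
  rewrite leNgt; apply/negP => h; apply: nx; exists (A, phi) => /=.
  by have [dA dphi e] := rep; rewrite -e; split=> //; exact: ltW.
pose x k := sval (cid (bad k)).
have hx k := svalP (cid (bad k)); rewrite -/(x _) in hx.
pose A k := (x k).1; pose phi k := (x k).2; pose S k := nrm (A k) (phi k).
have expS k : expR k.+1%:R <= S k by case: (hx k).
have S0 k : 0 < S k by apply: lt_le_trans (expS k); exact: expR_gt0.
(* The transpose is taken because [ssq] depends on A through A^T A, whereas [eigenvalue_growth]
   treats X X^T. *)
have [|k||u [s [U [y [e [[uu uE uU UU] [spos sy sumy] He ey]]]]]] :=
    @eigenvalue_growth _ (fun k => (A k)^T) S.
- by move=> k; rewrite det_tr; case: (hx k).
- by rewrite trmxK mxtrace_mulC; case: (nrm_le (lexx (S k))).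
- exact: expS.
have [|k||v [t [V [z [f [[vv vE vV VV] [tpos tz sumz] Hf fz]]]]]] :=
    @eigenvalue_growth _ phi S.
- by move=> k; case: (hx k).
- by case: (nrm_le (lexx (S k))).
- exact: expS.
(* The slices of [C] in the eigenbases of A_k^T A_k and phi_k phi_k^T, where [ssq_act_diag] applies;
   they converge to an orthogonal transform of [C]. *)
pose c k := act (u k) (v k)^T C; pose c' := act U V^T C.
have cc' l : mcvg (c^~ l) (c' l).
  by apply: mcvg_act => //; [exact: mcvgT|move=> j; exact: mcvg_cst].
have ssqE k : ssq (act (A k) (phi k) C) =
    \sum_l \sum_i \sum_j s k 0 i * s k 0 j * t k 0 l * c k l i j ^+ 2.
  have -> : act (A k) (phi k) C = act (A k *m (u k)^T) (v k *m phi k) (c k).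
    by rewrite act_comp -mulmxA (mulmx1C (uu k)) mulmx1 mulmxA (mulmx1C (vv k)) mul1mx.
  apply: ssq_act_diag.
    have := uE k; rewrite trmxK => h.
    rewrite trmx_mul trmxK !mulmxA -(mulmxA (u k)) h !mulmxA uu mul1mx -mulmxA uu.
    by rewrite mulmx1.
  rewrite trmx_mul !mulmxA -(mulmxA (v k)) vE !mulmxA vv mul1mx -mulmxA vv.
  by rewrite mulmx1.
have w0 : (fun k => (ln (S k))^-1) @ omega --> (0 : R).
  apply: (@ucvg0_squeeze _ harmonic 1).
    by apply: ucvg_seq; exact: cvg_harmonic.
  have lnS k : k.+1%:R <= ln (S k) by rewrite -[leLHS]expRK ler_ln ?posrE ?expR_gt0.
  move=> k; have l0 : 0 < ln (S k) by apply: lt_le_trans (lnS k).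
  by rewrite invr_ge0 (ltW l0) /= mul1r lef_pV2 ?posrE.
(* With q = s_i s_j t_l, the bound q c^2 <= M and ln q <= q give (ln q / ln S) c^2 <= M / ln S,
   which tends to 0. So no nonzero entry of c' has positive weight. *)
have le0 l i j : (y 0 i + y 0 j + z 0 l) * c' l i j ^+ 2 <= 0.
  have := @ucvg_le R (fun k => (ln (s k 0 i) / ln (S k) + ln (s k 0 j) / ln (S k)
    + ln (t k 0 l) / ln (S k)) * c k l i j ^+ 2) (fun k => M * (ln (S k))^-1)
    ((y 0 i + y 0 j + z 0 l) * c' l i j ^+ 2) (M * 0).
  rewrite mulr0; apply.
  - move=> k; rewrite -!mulrDl mulrAC ler_wpM2r //.
      rewrite invr_ge0 ln_ge0 //; apply: le_trans (expS k).
      by rewrite -[leLHS]expR0 ler_expR.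
    rewrite -lnM ?posrE // -lnM ?posrE ?mulr_gt0 //.
    set q := _ * _ * _; have q0 : 0 < q by rewrite !mulr_gt0.
    apply: le_trans (_ : q * c k l i j ^+ 2 <= _).
      by rewrite ler_wpM2r ?sqr_ge0 // ln_le.
    have [_ _ h _ _] := hx k; apply: le_trans h; rewrite ssqE.
    have p0 l' i' j' : 0 <= s k 0 i' * s k 0 j' * t k 0 l' * c k l' i' j' ^+ 2.
      by rewrite mulr_ge0 ?sqr_ge0 // ltW // !mulr_gt0.
    rewrite (bigD1 l) //= (bigD1 i) //= (bigD1 j) //= -!addrA lerDl.
    by rewrite !addr_ge0 // ?sumr_ge0 // => ? _; rewrite ?sumr_ge0 // => ? _;
      rewrite sumr_ge0.
  - apply: cvgM; first by apply: cvgD => //; apply: cvgD.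
    by under eq_fun => k do rewrite expr2; rewrite expr2; apply: cvgM; exact: cc'.
  - by rewrite -[X in _ --> X](mulr0 M); apply: cvgM => //; exact: cvg_cst.
have VV' := mulmx1C VV; have UU' := mulmx1C UU.
have c'C : act U^T V c' = C by rewrite act_comp UU' VV' act1.
have sc' : skew c' by exact: skew_act.
have ec' : einstein c' a b by apply: einstein_act; rewrite ?trmxK.
(* These nonpositive terms sum to 0 by [einstein_weight_sum], since y and z have sum 0. *)
have eq0 l i j : (y 0 i + y 0 j + z 0 l) * c' l i j ^+ 2 = 0.
  have := einstein_weight_sum y z sc' ec'; rewrite sumy sumz !mulr0 addr0 oppr0.
  pose g l i j := - ((y 0 i + y 0 j + z 0 l) * c' l i j ^+ 2).
  have g0 l' i' j' : 0 <= g l' i' j' by rewrite oppr_ge0 le0.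
  move=> h; have : \sum_l \sum_i \sum_j g l i j = 0.
    move/(congr1 -%R): h; rewrite oppr0 -sumrN; apply: etrans; apply: eq_bigr => l' _.
    by rewrite -sumrN; apply: eq_bigr => i' _; rewrite -sumrN.
  move/eqP; rewrite psumr_eq0; last first.
    by move=> l' _; rewrite sumr_ge0 // => i' _; rewrite sumr_ge0.
  move/allP/(_ l (mem_index_enum _)) => /=; rewrite psumr_eq0; last first.
    by move=> i' _; rewrite sumr_ge0.
  move/allP/(_ i (mem_index_enum _)) => /=; rewrite psumr_eq0 //.
  move/allP/(_ j (mem_index_enum _)) => /=; rewrite oppr_eq0 => /eqP //.
pose dy : 'rV[R]_m := \row_i expR (- y 0 i).
pose dz : 'rV[R]_n := \row_l expR (- z 0 l).
pose A0 := U^T *m diag_mx dy *m U; pose phi0 := V^T *m diag_mx dz *m V.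
have fixC : act A0 phi0 C = C.
  have -> : act A0 phi0 C = act U^T V (act (diag_mx dy) (diag_mx dz) c').
    by rewrite !act_comp /A0 /phi0 !mulmxA.
  by rewrite act_diag_fix.
have det_sandwich p (W : 'M[R]_p) (d : 'rV[R]_p) : W *m W^T = 1%:M ->
    \sum_i d 0 i = 0 ->
    \det (W^T *m diag_mx (\row_i expR (- d 0 i)) *m W) = 1.
  move=> WW sd; rewrite !det_mulmx mulrAC -det_mulmx (mulmx1C WW) det1 mul1r.
  rewrite det_diag; under eq_bigr => i _ do rewrite mxE.
  by rewrite -expR_sum sumrN sd oppr0 expR0.
have [sA0 A0A0] := sandwich_diag dy UU; rewrite -/A0 in sA0 A0A0.
have [sp0 p0p0] := sandwich_diag dz VV; rewrite -/phi0 in sp0 p0p0.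
(* Since (A0, phi0) fixes [C], the pair (A_k A0, phi0 phi_k) represents the same orbit point, so its
   norm is at least S_k. *)
have minS k : 1 <= \tr ((S k)^-1 *: ((A k)^T *m A k) *m (A0^T *m A0))
    + \tr ((S k)^-1 *: (phi k *m (phi k)^T) *m (phi0^T *m phi0)).
  rewrite -!scalemxAl !mxtraceZ -mulrDr mulrC ler_pdivlMr // mul1r.
  have [dA dp _ min _] := hx k.
  have -> : \tr ((A k)^T *m A k *m (A0^T *m A0)) =
      \tr (A k *m A0 *m (A k *m A0)^T).
    by rewrite tr_gram_mulr sA0.
  rewrite -tr_gram_mul; apply: min; split.
  - by rewrite det_mulmx dA det_sandwich // mulr1.
  - by rewrite det_mulmx dp det_sandwich // mul1r.
  - by rewrite -act_comp fixC.
have lim : 1 <= \sum_i e 0 i * (expR (- y 0 i)) ^+ 2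
    + \sum_l f 0 l * (expR (- z 0 l)) ^+ 2.
  apply: (ucvg_le minS); first exact: cvg_cst.
  have -> : \sum_i e 0 i * (expR (- y 0 i)) ^+ 2 =
      \tr (U^T *m diag_mx e *m U *m (A0^T *m A0)).
    rewrite sA0 A0A0 tr_sandwich_diag //.
    by apply: eq_bigr => i _; rewrite !mxE.
  have -> : \sum_l f 0 l * (expR (- z 0 l)) ^+ 2 =
      \tr (V^T *m diag_mx f *m V *m (phi0^T *m phi0)).
    rewrite sp0 p0p0 tr_sandwich_diag //.
    by apply: eq_bigr => i _; rewrite !mxE.
  apply: cvgD; apply: ucvg_tr; apply: mcvgM => //; try exact: mcvg_cst.
  by move: He; under eq_fun => k do rewrite trmxK.
(* S_k is exactly the sum of the two traces, so the normalised matrices have total trace 1 for every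
   k. *)
have sumef : \sum_i e 0 i + \sum_l f 0 l = 1.
  have h : (fun k => \tr ((S k)^-1 *: ((A k)^T *m A k))
      + \tr ((S k)^-1 *: (phi k *m (phi k)^T))) @ omega -->
      \sum_i e 0 i + \sum_l f 0 l.
    rewrite -!mxtrace_diag.
    have -> : \tr (diag_mx e) = \tr (U^T *m diag_mx e *m U).
      by rewrite mxtrace_mulC mulmxA UU mul1mx.
    have -> : \tr (diag_mx f) = \tr (V^T *m diag_mx f *m V).
      by rewrite mxtrace_mulC mulmxA VV mul1mx.
    apply: cvgD; apply: ucvg_tr => //.
    by move: He; under eq_fun => k do rewrite trmxK.
  apply: (ucvg_uniq h).
  under eq_fun => k.
    rewrite !mxtraceZ -mulrDr [\tr (_^T *m _)]mxtrace_mulC -/(nrm _ _) -/(S k).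
    rewrite mulVf ?gt_eqF //; over.
  exact: cvg_cst.
(* An eigenvalue that survives normalisation has exponent 1, so [lim] turns into 1 <= exp(-1)^2, a
   contradiction. *)
have expE (d x0 : R) : x0 * (1 - d) = 0 -> x0 * expR (- d) ^+ 2 = x0 * expR (- 1) ^+ 2.
  move/eqP; rewrite mulf_eq0 => /orP[/eqP ->|]; first by rewrite !mul0r.
  by rewrite subr_eq0 => /eqP <-.
move: lim; under eq_bigr => i _ do rewrite (expE _ _ (ey i)).
under [X in _ + X]eq_bigr => l _ do rewrite (expE _ _ (fz l)).
rewrite -!mulr_suml -mulrDl sumef mul1r leNgt => /negP; apply.
by rewrite expr_lt1 ?expR_ge0 // -[X in _ < X]expR0 ltr_expR ltrN10.
Qed.

Lemma einstein_closed C a b : skew C -> einstein C a b -> uclosed (orbit C).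
Proof.
move=> sC eC D0 E CD0 DE0.
(* The norms of [D0 k] are bounded only for [omega]-almost all k; the other terms are replaced by
   [C] to get a uniform bound without changing the limit. *)
pose D k := if ssq (D0 k) <= ssq E + 1 then D0 k else C.
have CD k : orbit C (D k) by rewrite /D; case: ifP => // _; exact: orbit_refl.
have DM k : ssq (D k) <= ssq E + 1 + ssq C.
  have := ssq_ge0 C; have := ssq_ge0 E; rewrite /D; case: ifP; lra.
have DE l : mcvg (D^~ l) (E l).
  move=> i j; apply: cvg_trans (DE0 l i j); apply: near_eq_cvg.
  have : ssq E < ssq E + 1 by rewrite ltrDl.
  move/(cvgr_lt _ (ucvg_ssq DE0)); apply: filterS => k h.
  by rewrite /D ltW.
have [K hK] := minimal_reps_bounded (ssq E + 1 + ssq C) sC eC.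
pose Ak k := cid (min_rep (CD k)); pose pk k := cid (svalP (Ak k)).
have h k : is_rep C (D k) (sval (Ak k)) (sval (pk k)) by case: (svalP (pk k)).
have bd k : nrm (sval (Ak k)) (sval (pk k)) <= K.
  by have [rep mn] := svalP (pk k); exact: hK rep mn (DM k).
have [A [phi [rep _ _]]] := is_rep_limit h bd DE.
by exists A, phi.
Qed.

(** An element of GL x GL acts by a continuous bijection and normalises SL x SL, so it maps orbits
    to orbits. This brings closedness back from an orthonormal frame to mu. *)
Lemma uclosed_orbit_act C A phi : A \in unitmx -> phi \in unitmx ->
  uclosed (orbit C) -> uclosed (orbit (act A phi C)).
Proof.
move=> uA up cC D E DC DE.
have : orbit C (act (invmx A) (invmx phi) E).
  apply: (cC (fun k => act (invmx A) (invmx phi) (D k))) => [k|l].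
    have [B [psi [dB dpsi ->]]] := DC k.
    exists (invmx A *m B *m A), (phi *m psi *m invmx phi).
    rewrite !act_comp !mulmxA; split=> //; rewrite !det_mulmx mulrAC -det_mulmx.
      by rewrite mulVmx // det1 mul1r.
    by rewrite mulmxV // det1 mul1r.
  by apply: mcvg_act => //; exact: mcvg_cst.
move=> [B [psi [dB dpsi e]]].
exists (A *m B *m invmx A), (invmx phi *m psi *m phi); split.
- by rewrite !det_mulmx mulrAC -det_mulmx mulmxV // det1 mul1r.
- by rewrite !det_mulmx mulrAC -det_mulmx mulVmx // det1 mul1r.
- rewrite act_comp !mulmxA mulmxKV // mulmxV // mul1mx.
  by rewrite -act_comp -e act_comp mulmxV // mulVmx // act1.
Qed.

End EinsteinClosed.

(** * Inner products and their orthonormal frames *)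

Section Frames.
Variable R : realType.

Definition dotp p (x y : 'rV[R]_p) : R := (x *m y^T) 0 0.

Lemma dotpC p (x y : 'rV[R]_p) : dotp x y = dotp y x.
Proof. by rewrite /dotp -[x in LHS]trmxK -trmx_mul mxE. Qed.

Lemma dotpDl p (x y z : 'rV[R]_p) : dotp (x + y) z = dotp x z + dotp y z.
Proof. by rewrite /dotp mulmxDl mxE. Qed.

Lemma dotpZl p a (x z : 'rV[R]_p) : dotp (a *: x) z = a * dotp x z.
Proof. by rewrite /dotp -scalemxAl mxE. Qed.

Lemma dotpDr p (x y z : 'rV[R]_p) : dotp z (x + y) = dotp z x + dotp z y.
Proof. by rewrite dotpC dotpDl !(dotpC _ z). Qed.

Lemma dotpZr p a (x z : 'rV[R]_p) : dotp z (a *: x) = a * dotp z x.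
Proof. by rewrite dotpC dotpZl (dotpC _ z). Qed.

Lemma dotpNl p (x z : 'rV[R]_p) : dotp (- x) z = - dotp x z.
Proof. by rewrite -scaleN1r dotpZl mulN1r. Qed.

Lemma dotpNr p (x z : 'rV[R]_p) : dotp z (- x) = - dotp z x.
Proof. by rewrite -scaleN1r dotpZr mulN1r. Qed.

Lemma dotpMl p q (x : 'rV[R]_p) (M : 'M[R]_(p, q)) z :
  dotp (x *m M) z = dotp x (z *m M^T).
Proof. by rewrite /dotp trmx_mul trmxK mulmxA. Qed.

Lemma dotp0 p (x : 'rV[R]_p) : dotp x 0 = 0.
Proof. by rewrite /dotp trmx0 mulmx0 mxE. Qed.

Lemma dotp_sum p (x y : 'rV[R]_p) : dotp x y = \sum_i x 0 i * y 0 i.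
Proof. by rewrite /dotp mxE; apply: eq_bigr => i _; rewrite mxE. Qed.

Lemma dotp_row p q (x x' : 'rV[R]_p) (z z' : 'rV[R]_q) :
  dotp (row_mx x z) (row_mx x' z') = dotp x x' + dotp z z'.
Proof. by rewrite /dotp tr_row_mx mul_row_col mxE. Qed.

Lemma dotp_gt0 p (x : 'rV[R]_p) : x != 0 -> 0 < dotp x x.
Proof.
move=> x0; rewrite /dotp -trace_mx11 lt_neqAle tr_mul_trmx_ge0 andbT eq_sym.
by apply: contra x0 => /eqP /tr_mul_trmx_eq0 ->.
Qed.

Lemma dotp_inj p (x y : 'rV[R]_p) : (forall z, dotp x z = dotp y z) -> x = y.
Proof.
move=> h; apply/rowP => i; have := h (delta_mx 0 i).
by rewrite /dotp trmx_delta -!colE !mxE.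
Qed.

(** [x *m W] lists the coordinates of x in the orthonormal basis formed by the rows of [invmx W]. *)
Definition frame p (g : 'rV[R]_p -> 'rV[R]_p -> R) (W : 'M[R]_p) :=
  W \in unitmx /\ forall x y, g x y = dotp (x *m W) (y *m W).

Lemma riesz_frame p g (W : 'M[R]_p) f v : frame g W ->
  (forall y, g v y = f y) -> riesz g f = v.
Proof.
move=> [uW gW] gv; rewrite /riesz; case: xgetP => [u _ /= gu|/(_ v)]; last by [].
rewrite -[u](mulmxK uW) -[v](mulmxK uW); congr (_ *m _).
by apply: dotp_inj => z; rewrite -(mulmxKV uW z) -!gW gu gv.
Qed.

Lemma orthonormal_basis_frame p g (W : 'M[R]_p) X : frame g W ->
  orthonormal_basis g X <->
  ((\matrix_i X i) *m W) *m ((\matrix_i X i) *m W)^T = 1%:M.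
Proof.
move=> [_ gW].
have e i j : (((\matrix_i X i) *m W) *m ((\matrix_i X i) *m W)^T) i j = g (X i) (X j).
  rewrite gW dotp_sum mxE; apply: eq_bigr => k _; rewrite [X in _ * X]mxE.
  have h l : ((\matrix_i X i) *m W) l k = (X l *m W) 0 k.
    by rewrite !mxE; apply: eq_bigr => k' _; rewrite mxE.
  by rewrite !h.
split=> [h|h i j]; last by rewrite -e h mxE.
by apply/matrixP => i j; rewrite e h mxE.
Qed.

Lemma frame_onb p g (W : 'M[R]_p) : frame g W ->
  orthonormal_basis g (fun i => row i (invmx W)).
Proof.
move=> fW; apply/(orthonormal_basis_frame _ fW).
rewrite (_ : \matrix_i _ = invmx W); last by apply/row_matrixP => i; rewrite rowK.
by rewrite mulVmx ?trmx1 ?mulmx1 //; case: fW.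
Qed.

Lemma onbP p g (W : 'M[R]_p) : frame g W -> orthonormal_basis g (onb g).
Proof.
move=> fW; apply: xgetPex; exists (fun i => row i (invmx W)).
exact: frame_onb fW.
Qed.

Lemma dot_of_frame p (W : 'M[R]_p) : W \in unitmx ->
  exists g : {dot 'rV[R]_p for idfun}, frame g W.
Proof.
move=> uW; pose f (x y : 'rV[R]_p) : R := dotp (x *m W) (y *m W).
have fC x y : f x y = f y x by rewrite /f dotpC.
have fD y : {morph f^~ y : x x' / x + x'} by move=> x x'; rewrite /f mulmxDl dotpDl.
have fZ y a x : f (a *: x) y = a * f x y by rewrite /f -scalemxAl dotpZl.
have fB y : zmod_morphism (f^~ y).
  by move=> x x'; rewrite fD -scaleN1r fZ mulN1r.
have fB' x : zmod_morphism (f x).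
  by move=> y y'; rewrite fC fB !(fC x).
have fZ1 y : scalable_for *%R (f^~ y) by move=> a x; exact: fZ.
have fZ2 x : scalable_for (idfun \; *%R) (f x).
  by move=> a y; rewrite fC fZ (fC x).
have fH x y : f x y = (-1) ^+ false * idfun (f y x) by rewrite mul1r fC.
have fP u : u != 0 -> 0 < f u u.
  move=> u0; apply: dotp_gt0; apply: contra u0 => /eqP h.
  by rewrite -(mulmxK uW u) h mul0mx.
pose b := isBilinear.Build R _ _ _ *%R (idfun \; *%R) f fB fB' fZ1 fZ2.
pose h := isHermitianSesquilinear.Build R _ false idfun f fH.
pose d := isDotProduct.Build R _ f fP.
pose g : {dot 'rV[R]_p for idfun} := HB.pack f b h d.
by exists g; split.
Qed.

Lemma dot_frame p (g : 'rV[R]_p -> 'rV[R]_p -> R) :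
  (forall a x y z, g (a *: x + y) z = a * g x z + g y z) ->
  (forall x y, g x y = g y x) -> (forall x, x != 0 -> 0 < g x x) ->
  exists2 G : 'M[R]_p, G^T = G & (forall x y, g x y = dotp (x *m G) y) /\
    exists2 W : 'M[R]_p, W \in unitmx & G = W *m W^T.
Proof.
move=> gl gC gP; pose G : 'M[R]_p := \matrix_(i, j) g (delta_mx 0 i) (delta_mx 0 j).
have g0 z : g 0 z = 0.
  by have := gl (-1) 0 0 z; rewrite scaler0 add0r mulN1r => ->; rewrite addNr.
have gsum (I : finType) (c : I -> R) (x : I -> 'rV[R]_p) z :
    g (\sum_i c i *: x i) z = \sum_i c i * g (x i) z.
  by elim/big_rec2: _ => [|i a b _ <-]; rewrite ?g0 ?gl.
have gG x y : g x y = dotp (x *m G) y.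
  rewrite [x in LHS]row_sum_delta gsum dotp_sum.
  under eq_bigr => i _ do rewrite gC [y in g y _]row_sum_delta gsum mulr_sumr.
  rewrite exchange_big /=; apply: eq_bigr => j _.
  rewrite mxE mulr_suml; apply: eq_bigr => i _; rewrite mxE gC; ring.
have sG : G^T = G by apply/matrixP => i j; rewrite !mxE gC.
exists G => //; split=> //; apply: posdef_factor => // x x0.
by rewrite -/(dotp (x *m G) x) -gG gP.
Qed.

(* Block Cholesky factorisation: the second summand is preserved by the frame. *)
Lemma dot_adapted_frame p q (g : {dot 'rV[R]_(p + q) for idfun}) :
  exists (W1 : 'M[R]_p) (K : 'M[R]_(p, q)) (W2 : 'M[R]_q),
    [/\ W1 \in unitmx, W2 \in unitmx & frame g (block_mx W1 K 0 W2)].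
Proof.
have gC x y : g x y = g y x by rewrite hermC mul1r.
have gl a x y z : g (a *: x + y) z = a * g x z + g y z by rewrite linearPl.
have gP x : x != 0 -> 0 < g x x by exact: neq0_dnorm_gt0.
have [G sG [gG _]] := dot_frame gl gC gP.
have GE : G = block_mx (ulsubmx G) (ursubmx G) (ursubmx G)^T (drsubmx G).
  by rewrite trmx_ursub sG submxK.
set A := ulsubmx G in GE; set B := ursubmx G in GE; set D := drsubmx G in GE.
have sA : A^T = A by rewrite /A trmx_ulsub sG.
have sD : D^T = D by rewrite /D trmx_drsub sG.
have gE x z y w : g (row_mx x z) (row_mx y w) =
    dotp (x *m A + z *m B^T) y + dotp (x *m B + z *m D) w.
  by rewrite gG GE mul_row_block dotp_row.
have [|W2 uW2 DE] := @posdef_factor _ _ D sD.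
  move=> z z0; have := gP (row_mx 0 z).
  rewrite gE !mul0mx !add0r dotp0 add0r.
  apply; apply: contra z0 => /eqP; rewrite -row_mx0 => /eq_row_mx[_ ->] //.
have [K BE] : exists K, B = K *m W2^T.
  by exists (B *m invmx W2^T); rewrite mulmxKV ?unitmx_tr.
have [||W1 uW1 AE] := @posdef_factor _ _ (A - K *m K^T).
- by rewrite linearB /= trmx_mul trmxK sA.
(* This z makes (x, z) orthogonal to the second summand, so the value of g on (x, z) is the Schur
   complement A - K K^T evaluated at x. *)
- move=> x x0; pose z := - (x *m K *m invmx W2).
  have := gP (row_mx x z); rewrite gE.
  have h1 : x *m B + z *m D = 0.
    by rewrite BE DE /z mulNmx !mulmxA mulmxKV // addrN.
  have h2 : x *m A + z *m B^T = x *m (A - K *m K^T).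
    by rewrite BE trmx_mul trmxK /z mulNmx !mulmxA mulmxKV // mulmxBr mulmxA.
  rewrite h1 h2 (dotpC 0) dotp0 addr0; apply.
  by apply: contra x0 => /eqP; rewrite -row_mx0 => /eq_row_mx[-> _].
exists W1, K, W2; split=> //; split.
  by rewrite unitmxE det_ublock unitrM -!unitmxE uW1.
move=> x y; rewrite gG /dotp trmx_mul !mulmxA -(mulmxA x (block_mx _ _ _ _)).
congr ((x *m _ *m y^T) 0 0).
rewrite tr_block_mx trmx0 mulmx_block !mul0mx !mulmx0 !add0r.
rewrite GE -AE subrK -BE -DE; congr block_mx.
by rewrite BE trmx_mul trmxK.
Qed.

Lemma frame_perp p q (g : 'rV[R]_(p + q) -> 'rV[R]_(p + q) -> R) W1 K W2 :
  W1 \in unitmx -> W2 \in unitmx -> frame g (block_mx W1 K 0 W2) -> n1_perp_n2 g ->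
  [/\ K = 0, frame (on_n1 g) W1 & frame (on_n2 g) W2].
Proof.
move=> uW1 uW2 [_ gW] perp.
have gE x z y w : g (row_mx x z) (row_mx y w) =
    dotp (x *m W1) (y *m W1) + dotp (x *m K + z *m W2) (y *m K + w *m W2).
  by rewrite gW !mul_row_block !mulmx0 !addr0 dotp_row.
have K0 : K = 0.
  apply/row_matrixP => i; rewrite row0; apply: dotp_inj => w.
  have := perp (delta_mx 0 i) (w *m invmx W2).
  rewrite gE !mul0mx dotp0 !add0r addr0 mulmxKV // -rowE => ->.
  by rewrite dotpC dotp0.
split=> //; split=> // x y.
  by rewrite /on_n1 gE K0 !mulmx0 !mul0mx !addr0 dotp0 addr0.
by rewrite /on_n2 gE !mul0mx !add0r dotp0 add0r.
Qed.

Lemma dot_perp_frame p q (g : {dot 'rV[R]_(p + q) for idfun}) : n1_perp_n2 g ->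
  exists (W1 : 'M[R]_p) (W2 : 'M[R]_q),
    [/\ frame (on_n1 g) W1, frame (on_n2 g) W2 & frame g (block_mx W1 0 0 W2)].
Proof.
move=> perp; have [W1 [K [W2 [u1 u2 f]]]] := dot_adapted_frame g.
have [K0 f1 f2] := frame_perp u1 u2 f perp.
by exists W1, W2; rewrite K0 in f.
Qed.

Lemma dot_of_blocks p q (W1 : 'M[R]_p) (W2 : 'M[R]_q) :
  W1 \in unitmx -> W2 \in unitmx ->
  exists g : {dot 'rV[R]_(p + q) for idfun},
    [/\ n1_perp_n2 g, frame g (block_mx W1 0 0 W2), frame (on_n1 g) W1 &
        frame (on_n2 g) W2].
Proof.
move=> u1 u2; have [|g fg] := @dot_of_frame _ (block_mx W1 0 0 W2).
  by rewrite unitmxE det_ublock unitrM -!unitmxE u1.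
have perp : n1_perp_n2 g.
  move=> x z; case: fg => _ ->; rewrite !mul_row_block !mul0mx !mulmx0 !addr0 !add0r.
  by rewrite dotp_row (dotpC 0) !dotp0 addr0.
by exists g; have [_ f1 f2] := frame_perp u1 u2 fg perp.
Qed.

End Frames.

(** * Translation between tensors and tuples of slices *)

Section Dictionary.
Variables (R : realType) (m n : nat).
Implicit Types (mu nu : 'M[R]_(m * m, n)) (C D : 'I_n -> 'M[R]_m).

Definition slices mu : 'I_n -> 'M[R]_m := fun l => vec_mx (col l mu)^T.

Definition tensor_of C : 'M[R]_(m * m, n) := \matrix_(k, l) mxvec (C l) 0 k.

(** The bilinear map with slices [C], free of the [mxvec] encoding. *)
Definition beta C (x y : 'rV[R]_m) : 'rV[R]_n := \row_l dotp (x *m C l) y.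

Lemma tensor_ofK C : slices (tensor_of C) = C.
Proof.
apply/funext => l; rewrite /slices -[RHS]mxvecK; congr vec_mx.
by apply/rowP => k; rewrite !mxE.
Qed.

Lemma bil_beta mu : bil mu = beta (slices mu).
Proof.
apply/funext => x; apply/funext => y; apply/rowP => l.
rewrite [RHS]mxE /bil /slices.
transitivity ((mxvec (x^T *m y) *m col l mu) 0 0).
  by rewrite !mxE; apply: eq_bigr => k _; rewrite !mxE.
rewrite -[col l mu in LHS]trmxK -[(col l mu)^T in LHS]vec_mxK.
by rewrite mxvec_dotmul.
Qed.

Lemma beta_act C A phi x y : beta C (x *m A) (y *m A) *m phi = beta (act A phi C) x y.
Proof.
apply/rowP => l; rewrite !mxE /act mulmx_sumr /dotp mulmx_suml summxE.
apply: eq_bigr => k _; rewrite mxE -scalemxAr -scalemxAl [RHS]mxE mulrC.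
by rewrite /dotp trmx_mul !mulmxA.
Qed.

Lemma beta_inj C D : (forall x y, beta C x y = beta D x y) -> C = D.
Proof.
move=> h; apply/funext => l; apply/row_matrixP => i; apply: dotp_inj => z.
by have /rowP/(_ l) := h (delta_mx 0 i) z; rewrite !mxE -!rowE.
Qed.

Lemma beta_skewE C x y : skew C -> beta C x y = - beta C y x.
Proof.
by move=> sC; apply/rowP => l; rewrite !mxE dotpMl sC mulmxN dotpNr dotpC.
Qed.

Lemma slices_skew mu : Vnm mu <-> skew (slices mu).
Proof.
rewrite /Vnm /= bil_beta; split=> [h|sC x y]; last exact: beta_skewE.
suff : slices mu = (fun l => - (slices mu l)^T).
  by move=> e l; rewrite [in RHS]e opprK.
apply: beta_inj => x y; rewrite h; apply/rowP => l.
by rewrite !mxE mulmxN dotpNl dotpMl dotpC.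
Qed.

Lemma skew_tensor_of C : Vnm (tensor_of C) <-> skew C.
Proof. by rewrite slices_skew tensor_ofK. Qed.

Lemma pencil_beta C x y z : dotp (beta C x y) z = dotp (x *m pencil C z) y.
Proof.
rewrite dotp_sum /pencil mulmx_sumr /dotp mulmx_suml summxE.
by apply: eq_bigr => l _; rewrite -scalemxAr -scalemxAl [RHS]mxE [X in X * _]mxE mulrC.
Qed.

Lemma SL_orbit_slices mu nu : SL_orbit mu nu <-> orbit (slices mu) (slices nu).
Proof.
rewrite /SL_orbit /= !bil_beta; split.
  move=> [psi [phi [dpsi dphi e]]]; exists (invmx psi), phi; split=> //.
    by rewrite det_inv dpsi invr1.
  by apply: beta_inj => x y; rewrite -beta_act e.
move=> [A [phi [dA dphi e]]]; exists (invmx A), phi; split=> //.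
  by rewrite det_inv dA invr1.
by move=> x y; rewrite invmxK beta_act e.
Qed.

Lemma SL_orbit_Vnm mu nu : Vnm mu -> SL_orbit mu nu -> Vnm nu.
Proof.
by rewrite !slices_skew SL_orbit_slices => sC [A [phi [_ _ ->]]]; exact: skew_act.
Qed.

Lemma mcvg_slices (nu : nat -> 'M[R]_(m * m, n)) nu' :
  mcvg nu nu' -> forall l, mcvg (fun k => slices (nu k) l) (slices nu' l).
Proof.
by move=> h l i j; rewrite /slices !mxE; under eq_fun => k do rewrite !mxE; exact: h.
Qed.

Lemma mcvg_tensor_of (D : nat -> 'I_n -> 'M[R]_m) E :
  (forall l, mcvg (D^~ l) (E l)) -> mcvg (fun k => tensor_of (D k)) (tensor_of E).
Proof.
move=> h k l; rewrite mxE; under eq_fun => p do rewrite mxE.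
by case/mxvec_indexP: k => i j; rewrite mxvecE; under eq_fun => p do rewrite mxvecE; exact: h.
Qed.

(** Balls of radius 1/(k+1) turn a closure point into a limit of a sequence; conversely, an
    ultralimit meets every ball around it. *)
Lemma closed_SL_orbit mu : Vnm mu ->
  closed (SL_orbit mu : set (subspace (@Vnm R m n))) <-> uclosed (orbit (slices mu)).
Proof.
move=> Vmu; split=> [cl D E DC DE|ucl p pcl].
  have sC : skew (slices mu) by exact/slices_skew.
  have sE : skew E.
    move=> l; apply: (mcvg_uniq (mcvgT (DE l))) => i j.
    have sD k : skew (D k) by have [A [phi [_ _ ->]]] := DC k; exact: skew_act.
    under eq_fun => k do rewrite sD mxE.
    by rewrite mxE; apply: cvgN; exact: DE.
  have VE : Vnm (tensor_of E) by exact/skew_tensor_of.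
  rewrite -(tensor_ofK E) -SL_orbit_slices; apply: cl => B.
  rewrite /nbhs /= -nbhs_subspace_in // => /nbhs_ballP[e /= e0 eB].
  have h : omega (fun k => forall i j, `|tensor_of E i j - tensor_of (D k) i j| < e).
    apply: filter_forall => i; apply: filter_forall => j.
    have /(_ i j)/cvgrPdist_lt := @mcvg_tensor_of D E DE.
    exact.
  have [k hk] := filter_ex h; exists (tensor_of (D k)).
  have Dk : SL_orbit mu (tensor_of (D k)) by rewrite SL_orbit_slices tensor_ofK.
  by split=> //; apply: eB; [split|exact: SL_orbit_Vnm Vmu Dk].
(* In [subspace] a point off [Vnm] is isolated, so it is in the closure of the orbit only by
   belonging to it. *)
have [Vp|nVp] := pselect (Vnm p); last first.
  have [|x [xO /= xp]] := pcl [set p]; last by rewrite -xp.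
  by rewrite /nbhs /= -nbhs_subspace_out.
have app (k : nat) : exists q, SL_orbit mu q /\ forall i j, `|p i j - q i j| < k.+1%:R^-1.
  have k0 : 0 < k.+1%:R^-1 :> R by rewrite invr_gt0.
  have [|q [qO qb]] := pcl (@ball R 'M[R]_(m * m, n) p k.+1%:R^-1); last first.
    by exists q; split=> //; case: qb.
  rewrite /nbhs /= -nbhs_subspace_in //; apply: filterS
    (@nbhsx_ballx R 'M[R]_(m * m, n) p _ k0).
  by move=> q.
pose q k := sval (cid (app k)).
have [qO qb] : (forall k, SL_orbit mu (q k)) /\
    forall k i j, `|p i j - q k i j| < k.+1%:R^-1.
  by split=> k; case: (svalP (cid (app k))).
have qp : mcvg q p.
  move=> i j; apply: ucvg_seq; apply/cvgrPdist_lt => e e0.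
  have /cvgrPdist_lt/(_ _ e0) := @cvg_harmonic R; apply: filterS => k.
  by rewrite sub0r normrN ger0_norm //=; exact/lt_trans/qb.
rewrite SL_orbit_slices; apply: (ucl (fun k => slices (q k))) => [k|].
  by rewrite -SL_orbit_slices.
exact: mcvg_slices.
Qed.

Section Jmap.
Variables (g : 'rV[R]_(m + n) -> 'rV[R]_(m + n) -> R) (mu : 'M[R]_(m * m, n)).
Variables (W1 : 'M[R]_m) (W2 : 'M[R]_n).
Hypotheses (f1 : frame (on_n1 g) W1) (f2 : frame (on_n2 g) W2).

Lemma dotp_mulmx2 p q (x y : 'rV[R]_p) (W : 'M[R]_(p, q)) :
  dotp (x *m W) (y *m W) = dotp (x *m (W *m W^T)) y.
Proof. by rewrite /dotp trmx_mul !mulmxA. Qed.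

Lemma row_lin1_mx p q (f : 'rV[R]_p -> 'rV[R]_q) i :
  row i (lin1_mx f) = f (delta_mx 0 i).
Proof. by apply/rowP => j; rewrite !mxE. Qed.

(** The products W W^T are Gram matrices: the one on n2 enters by pairing with Z, the one on n1 is
    inverted by the Riesz representation. *)
Lemma Jmap_frame Z :
  Jmap g mu Z = pencil (slices mu) (Z *m (W2 *m W2^T)) *m invmx (W1 *m W1^T).
Proof.
have [u1 g1] := f1; have [u2 g2] := f2.
have uG : W1 *m W1^T \in unitmx by rewrite unitmx_mul unitmx_tr u1.
apply/row_matrixP => i; rewrite row_lin1_mx rowE.
apply: (riesz_frame f1) => y; rewrite g1 g2 bil_beta.
rewrite dotp_mulmx2 [RHS]dotpC dotp_mulmx2 [RHS]dotpC pencil_beta.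
by rewrite -(mulmxA _ (_ *m invmx _)) mulmxKV.
Qed.

(** [O] holds the frame coordinates of the basis Z, so J(Z_i) is conjugate to a slice of the tuple
    read in the frame and rotated by [O]. *)
Lemma Jmap_act Z i : let O := (\matrix_i Z i) *m W2 in
  Jmap g mu (Z i) = W1 *m act (invmx W1) (W2 *m O^T) (slices mu) i *m invmx W1.
Proof.
move=> O; have [u1 _] := f1.
rewrite Jmap_frame -[act _ _ _ i]pencil_delta pencil_act.
rewrite trmx_mul trmxK -rowE row_mul /O row_mul rowK -!mulmxA.
rewrite (mulmxA W1) mulmxV // mul1mx; congr (_ *m _).
have uG : W1 *m W1^T \in unitmx by rewrite unitmx_mul unitmx_tr u1.
apply: (can_inj (mulmxK uG)); rewrite mulVmx // -!mulmxA (mulmxA _ W1) mulVmx // mul1mx.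
by rewrite -trmx_mul mulmxV // trmx1.
Qed.

(** Conjugation by W1 preserves scalar matrices and traces, and the orthogonal matrix [O] preserves
    [einstein]. As the right side does not mention Z, the condition is independent of the basis. *)
Lemma J_condition_frame a b Z : orthonormal_basis (on_n2 g) Z ->
  J_condition g mu a b Z <-> einstein (act (invmx W1) W2 (slices mu)) a b.
Proof.
move/(orthonormal_basis_frame _ f2); set O := _ *m W2 => OO.
have [u1 _] := f1; set C := act _ _ _.
pose D := act 1%:M O^T C.
have JD i : Jmap g mu (Z i) = W1 *m D i *m invmx W1.
  by rewrite Jmap_act /D act_comp mul1mx.
have DE : einstein D a b <-> einstein C a b.
  split=> h; last by apply: einstein_act; rewrite ?trmx1 ?mulmx1 ?trmxK ?(mulmx1C OO).
  have -> : C = act 1%:M O D by rewrite act_comp mulmx1 (mulmx1C OO) act1.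
  by apply: einstein_act; rewrite ?trmx1 ?mulmx1.
rewrite -DE /J_condition /einstein.
have JJ i j : Jmap g mu (Z i) *m Jmap g mu (Z j) = W1 *m (D i *m D j) *m invmx W1.
  by rewrite !JD -!mulmxA (mulmxA (invmx W1) W1) mulVmx // mul1mx.
have -> : \sum_i Jmap g mu (Z i) *m Jmap g mu (Z i) = W1 *m sumsq D *m invmx W1.
  by rewrite mulmx_sumr mulmx_suml; apply: eq_bigr => i _; exact: JJ.
have sc (X : 'M[R]_m) : W1 *m X *m invmx W1 = a%:M <-> X = a%:M.
  split=> [h|->]; last by rewrite mul_mx_scalar -scalemxAl mulmxV // scalemx1.
  have uV : invmx W1 \in unitmx by rewrite unitmx_inv.
  apply: (can_inj (mulKmx u1)); apply: (can_inj (mulmxK uV)).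
  by rewrite h mul_mx_scalar -scalemxAl mulmxV // scalemx1.
have trJ i j : \tr (Jmap g mu (Z i) *m Jmap g mu (Z j)) = \tr (D i *m D j).
  by rewrite JJ mxtrace_mulC mulKmx.
rewrite sc; split=> -[h1 h2]; split=> //.
  by apply/matrixP => i j; rewrite !mxE -mulr_natr -h2 trJ.
by move=> i j; move/matrixP/(_ i j): h2; rewrite !mxE trJ mulr_natr.
Qed.

Lemma nonsing_slices : (forall Z, Z != 0 -> Jmap g mu Z \in unitmx) ->
  nonsing (slices mu).
Proof.
move=> h z z0; have [u1 _] := f1; have [u2 _] := f2.
have uG : W2 *m W2^T \in unitmx by rewrite unitmx_mul unitmx_tr u2.
have /h : z *m invmx (W2 *m W2^T) != 0.
  by apply: contra z0 => /eqP e; rewrite -(mulmxKV uG z) e mul0mx.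
by rewrite Jmap_frame mulmxKV // unitmx_mul => /andP[].
Qed.

End Jmap.

Lemma nonsingular_slices mu : nonsingular mu -> nonsing (slices mu).
Proof.
move=> [g [perp h]]; have [W1 [W2 [f1 f2 _]]] := dot_perp_frame perp.
exact: nonsing_slices f1 f2 h.
Qed.

End Dictionary.

(** * Ricci curvature and the nilsoliton equation *)

Section Ricci.
Variables (R : realType) (m n : nat).
Implicit Types (C : 'I_n -> 'M[R]_m).

Lemma lin1_mxE p q (f : 'rV[R]_p -> 'rV[R]_q) v :
  (forall a x y, f (a *: x + y) = a *: f x + f y) -> v *m lin1_mx f = f v.
Proof.
move=> fl; pose F : {linear 'rV[R]_p -> 'rV[R]_q} :=
  HB.pack f (GRing.isLinear.Build _ _ _ _ f fl).
exact: (mul_rV_lin1 F).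
Qed.

Lemma betaPl C a x x' y : beta C (a *: x + x') y = a *: beta C x y + beta C x' y.
Proof. by apply/rowP => l; rewrite !mxE mulmxDl dotpDl -scalemxAl dotpZl. Qed.

Lemma betaPr C a x y y' : beta C x (a *: y + y') = a *: beta C x y + beta C x y'.
Proof. by apply/rowP => l; rewrite !mxE dotpDr dotpZr. Qed.

Lemma beta0l C y : beta C 0 y = 0.
Proof. by apply/rowP => l; rewrite !mxE mul0mx dotpC dotp0. Qed.

Lemma beta0r C x : beta C x 0 = 0.
Proof. by apply/rowP => l; rewrite !mxE dotp0. Qed.

Lemma betaZr C a x y : beta C x (a *: y) = a *: beta C x y.
Proof. by rewrite -[a *: y]addr0 betaPr beta0r addr0. Qed.

Lemma pencilP C a z z' : pencil C (a *: z + z') = a *: pencil C z + pencil C z'.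
Proof.
rewrite /pencil scaler_sumr -big_split; apply: eq_bigr => l _ /=.
by rewrite !mxE scalerDl scalerA.
Qed.

Lemma pencil0 C : pencil C 0 = 0.
Proof. by rewrite /pencil big1 // => l _; rewrite mxE scale0r. Qed.

Lemma pencilZ C a z : pencil C (a *: z) = a *: pencil C z.
Proof. by rewrite -[a *: z]addr0 pencilP pencil0 addr0. Qed.

Definition bracket C (u v : 'rV[R]_(m + n)) : 'rV[R]_(m + n) :=
  row_mx 0 (beta C (lsubmx u) (lsubmx v)).

(* The Levi-Civita connection of the bracket with slices C for the standard
   inner product. *)
Definition nabla C (u v : 'rV[R]_(m + n)) : 'rV[R]_(m + n) :=
  row_mx (- 2^-1 *: (lsubmx v *m pencil C (rsubmx u) + lsubmx u *m pencil C (rsubmx v)))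
         (2^-1 *: beta C (lsubmx u) (lsubmx v)).

Definition curv C u v w :=
  nabla C u (nabla C v w) - nabla C v (nabla C u w) - nabla C (bracket C u v) w.

Lemma nabla_row C x z y w : nabla C (row_mx x z) (row_mx y w) =
  row_mx (- 2^-1 *: (y *m pencil C z + x *m pencil C w)) (2^-1 *: beta C x y).
Proof. by rewrite /nabla !row_mxKl !row_mxKr. Qed.

Lemma nablaPl C a u u' v : nabla C (a *: u + u') v = a *: nabla C u v + nabla C u' v.
Proof.
rewrite /nabla !linearP /= pencilP betaPl mulmxDr mulmxDl -!scalemxAl -scalemxAr.
rewrite scale_row_mx add_row_mx; congr row_mx; last first.
  by rewrite scalerDr !scalerA mulrC.
rewrite [X in _ *: X]addrACA -scalerDr [LHS]scalerDr !scalerA.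
by rewrite [a * _]mulrC.
Qed.

Lemma nablaPr C a u v v' : nabla C u (a *: v + v') = a *: nabla C u v + nabla C u v'.
Proof.
rewrite /nabla !linearP /= pencilP betaPr mulmxDr mulmxDl -!scalemxAl -scalemxAr.
rewrite scale_row_mx add_row_mx; congr row_mx; last first.
  by rewrite scalerDr !scalerA mulrC.
rewrite [X in _ *: X]addrACA -scalerDr [LHS]scalerDr !scalerA.
by rewrite [a * _]mulrC.
Qed.

Lemma bracketPl C a u u' v :
  bracket C (a *: u + u') v = a *: bracket C u v + bracket C u' v.
Proof.
by rewrite /bracket !linearP /= betaPl scale_row_mx add_row_mx scaler0 addr0.
Qed.

Lemma curvPl C a u u' v w : curv C (a *: u + u') v w = a *: curv C u v w + curv C u' v w.
Proof.
rewrite /curv bracketPl !(nablaPl, nablaPr) !scalerBr !opprD.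
set A := a *: _; set B := nabla _ _ _; set D := a *: _; set E := nabla _ _ _.
set F := a *: _; set G := nabla _ _ _.
by rewrite [A + B + _]addrACA [X in X = _]addrACA.
Qed.

Lemma pencil_tr C z : skew C -> (pencil C z)^T = - pencil C z.
Proof.
move=> sC; rewrite /pencil linear_sum /= -sumrN; apply: eq_bigr => l _.
by rewrite linearZ /= sC scalerN.
Qed.

Lemma dotp_nabla C u v w : skew C ->
  dotp (nabla C u v) w = 2^-1 * (dotp (bracket C u v) w - dotp (bracket C v w) u
    + dotp (bracket C w u) v).
Proof.
move=> sC; rewrite -[u]hsubmxK -[v]hsubmxK -[w]hsubmxK nabla_row /bracket.
rewrite !row_mxKl !dotp_row ![dotp 0 _]dotpC !dotp0 !add0r !pencil_beta.
rewrite !(dotpZl, dotpDl) pencil_beta.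
rewrite [dotp (lsubmx w *m _) _]dotpMl pencil_tr // mulmxN dotpNr.
rewrite [dotp (lsubmx w) _]dotpC; ring.
Qed.

Lemma sum_beta_pencil C x y : skew C ->
  \sum_i (x *m pencil C (beta C (delta_mx 0 i) y)) 0 i = dotp (x *m sumsq C) y.
Proof.
move=> sC; rewrite /sumsq mulmx_sumr /dotp mulmx_suml summxE.
under eq_bigr => i _ do rewrite /pencil mulmx_sumr summxE.
rewrite exchange_big /=; apply: eq_bigr => l _.
transitivity (dotp (y *m (C l)^T) (x *m C l)).
  rewrite dotp_sum; apply: eq_bigr => i _; rewrite -scalemxAr mxE; congr (_ * _).
  by rewrite mxE dotpMl dotpC /dotp trmx_delta -colE mxE.
by rewrite dotpC -dotpMl -mulmxA.
Qed.

(** The trace splits over basis vectors of the two summands: n1 contributes 3/4 S and -1/4 G, n2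
    contributes -1/4 S. *)
Lemma ricci_standard C u v : skew C ->
  \tr (lin1_mx (fun w => curv C w u v)) =
  dotp (u *m block_mx (2^-1 *: sumsq C) 0 0 (- 4^-1 *: gram C)) v.
Proof.
move=> sC; rewrite -[u]hsubmxK -[v]hsubmxK.
set x := lsubmx u; set z := rsubmx u; set y := lsubmx v; set w := rsubmx v.
rewrite mul_row_block !mulmx0 addr0 add0r dotp_row -!scalemxAr !dotpZl.
rewrite /mxtrace big_split_ord /=.
have -> : \sum_(i < m) lin1_mx (fun t => curv C t (row_mx x z) (row_mx y w))
      (lshift n i) (lshift n i) =
    2^-1 * dotp (x *m sumsq C) y + 4^-1 * dotp (x *m sumsq C) y
    - 4^-1 * dotp (z *m gram C) w.
  transitivity (\sum_i (- 4^-1 * (pencil C (beta C x y)) i i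
     + - 4^-1 * (pencil C w *m pencil C z) i i
     + 4^-1 * (x *m pencil C (beta C (delta_mx 0 i) y)) 0 i
     + 2^-1 * (y *m pencil C (beta C (delta_mx 0 i) x)) 0 i)).
    apply: eq_bigr => i _; rewrite mxE delta_mx_lshift /curv /bracket !row_mxKl.
    rewrite !nabla_row ?(row_mxKl, row_mxKr) !pencil0 !mulmx0 !mul0mx !add0r !addr0.
    rewrite !opp_row_mx !add_row_mx row_mxEl.
    rewrite !pencilZ -!scalemxAr -!scalemxAl -mulmxA -!rowE.
    by rewrite !mxE; field.
  rewrite !big_split /= -!mulr_sumr !sum_beta_pencil //.
  have -> : \sum_i pencil C (beta C x y) i i = 0.
    have : \tr (pencil C (beta C x y)) = - \tr (pencil C (beta C x y)).
      by rewrite -[LHS]mxtrace_tr pencil_tr // raddfN.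
    by rewrite /mxtrace; lra.
  have -> : \sum_i (pencil C w *m pencil C z) i i = dotp (z *m gram C) w.
    transitivity (\tr (pencil C w *m pencil C z)) => //.
    rewrite dotp_sum /pencil mulmx_suml raddf_sum; apply: eq_bigr => k _ /=.
    rewrite mulmx_sumr raddf_sum [X in _ = X * _]mxE mulr_suml.
    apply: eq_bigr => l _ /=.
    by rewrite -scalemxAl -scalemxAr !mxtraceZ [gram _ _ _]mxE mxtrace_mulC; ring.
  have -> : dotp (y *m sumsq C) x = dotp (x *m sumsq C) y.
    by rewrite dotpMl sumsq_sym // dotpC.
  ring.
have -> : \sum_(i < n) lin1_mx (fun t => curv C t (row_mx x z) (row_mx y w))
      (rshift m i) (rshift m i) = - 4^-1 * dotp (x *m sumsq C) y.
  rewrite /sumsq mulmx_sumr /dotp mulmx_suml summxE mulr_sumr.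
  apply: eq_bigr => i _; rewrite mxE delta_mx_rshift /curv /bracket !row_mxKl.
  rewrite !nabla_row ?(row_mxKl, row_mxKr) !beta0l !scaler0 !pencil0 !mulmx0 !mul0mx !addr0.
  rewrite !opp_row_mx !add_row_mx row_mxEr pencil_delta ?beta0l ?scaler0.
  rewrite betaZr oppr0 addr0 add0r scalerA -scaleNr mxE.
  have -> : beta C x (y *m C i) 0 i = - ((x *m (C i *m C i) *m y^T) 0 0).
    by rewrite mxE dotpC dotpMl sC mulmxN dotpNr dotpC /dotp !mulmxA.
  by field.
ring.
Qed.

(** The Ricci operator minus c acts by A = S/2 - c on n1 and phi = -G/4 - c on n2. Slicewise the
    derivation identity is A C_l + C_l A = sum_k phi_kl C_k; the two sides carry -2c and -c, which
    leaves the c of the soliton equation. *)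
Lemma derivation_soliton C c : skew C ->
  (forall x y, beta C x y *m (- 4^-1 *: gram C - c%:M) =
     beta C (x *m (2^-1 *: sumsq C - c%:M)) y + beta C x (y *m (2^-1 *: sumsq C - c%:M)))
  <-> soliton C c.
Proof.
move=> sC; set A := 2^-1 *: _ - _; set phi := _ - c%:M.
have sA : A^T = A by rewrite linearB /= linearZ /= sumsq_sym // tr_scalar_mx.
have eL x y : beta C x y *m phi = beta (act 1%:M phi C) x y.
  by rewrite -beta_act !mulmx1.
have eR (B : 'M[R]_m) x y : B^T = B -> beta C (x *m B) y + beta C x (y *m B) =
    beta (fun l => B *m C l + C l *m B) x y.
  move=> sB; apply/rowP => l; rewrite !mxE mulmxDr dotpDl !mulmxA; congr (_ + _).
  by rewrite -{1}sB -dotpMl.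
have lE l : (act 1%:M phi C l = A *m C l + C l *m A) <->
   2^-1 *: (sumsq C *m C l + C l *m sumsq C)
   + 4^-1 *: (\sum_k gram C k l *: C k) = c *: C l.
  have -> : act 1%:M phi C l = - (4^-1 *: (\sum_k gram C k l *: C k)) - c *: C l.
    have pE k : phi k l = - 4^-1 * gram C k l - c *+ (k == l) by rewrite !mxE.
    rewrite /act; under eq_bigr => k _ do rewrite trmx1 mul1mx mulmx1 pE scalerBl.
    rewrite sumrB; congr (_ - _).
      rewrite scaler_sumr -sumrN; apply: eq_bigr => k _.
      by rewrite mulNr scaleNr scalerA.
    rewrite (bigD1 l) //= big1 ?addr0 => [|k kl]; first by rewrite eqxx mulr1n.
    by rewrite (negPf kl) mulr0n scale0r.
  have -> : A *m C l + C l *m A = 2^-1 *: (sumsq C *m C l + C l *m sumsq C)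
      - c *: C l - c *: C l.
    rewrite mulmxBl mulmxBr mul_scalar_mx mul_mx_scalar -scalemxAl -scalemxAr scalerDr.
    by rewrite addrACA addrA.
  set X := 2^-1 *: _; set Y := 4^-1 *: _; split=> [/addIr h|<-].
    by apply/eqP; rewrite -subr_eq0 addrAC -h addNr.
  suff -> : X - (X + Y) = - Y by [].
  by rewrite opprD addrA subrr sub0r.
split=> [h l|h x y].
  apply/lE; suff -> : act 1%:M phi C = fun l => A *m C l + C l *m A by [].
  by apply: beta_inj => x y; rewrite -eL -eR // h.
rewrite eL eR //; suff -> : act 1%:M phi C = fun l => A *m C l + C l *m A by [].
by apply/funext => l; exact/lE.
Qed.

Section Frame.
Variables (g : 'rV[R]_(m + n) -> 'rV[R]_(m + n) -> R) (mu : 'M[R]_(m * m, n)).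
Variables (W1 : 'M[R]_m) (K : 'M[R]_(m, n)) (W2 : 'M[R]_n).
Hypotheses (u1 : W1 \in unitmx) (fW : frame g (block_mx W1 K 0 W2)) (Vmu : Vnm mu).
Local Notation W := (block_mx W1 K 0 W2).
Local Notation C := (act (invmx W1) W2 (slices mu)).
Local Notation br := (lie_bracket mu).
Implicit Types u v w : 'rV[R]_(m + n).

Lemma lsubmx_frame u : lsubmx (u *m W) = lsubmx u *m W1.
Proof. by rewrite -{1}[u]hsubmxK mul_row_block mulmx0 addr0 row_mxKl. Qed.

(** The block [K] drops out: the n1-component of [u *m W] is that of u times [W1], and brackets lie
    in n2, where W acts by [W2]. *)
Lemma bracket_frame u v : br u v *m W = bracket C (u *m W) (v *m W).
Proof.
rewrite /bracket /lie_bracket mul_row_block !mul0mx mulmx0 !add0r !lsubmx_frame.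
by rewrite -beta_act !mulmxK // bil_beta.
Qed.

Let sC : skew C. Proof. by apply: skew_act; exact/slices_skew. Qed.

Lemma levi_civita_frame u v : levi_civita br g u v *m W = nabla C (u *m W) (v *m W).
Proof.
have [uW gW] := fW; rewrite -[RHS](mulmxKV uW); congr (_ *m _).
apply: (riesz_frame fW) => w.
by rewrite !gW mulmxKV // !bracket_frame dotp_nabla.
Qed.

Lemma curvature_frame u v w :
  curvature br g u v w *m W = curv C (u *m W) (v *m W) (w *m W).
Proof. by rewrite /curvature !mulmxBl !levi_civita_frame bracket_frame. Qed.

Lemma ricci_frame u v : ricci br g u v =
  dotp (u *m W *m block_mx (2^-1 *: sumsq C) 0 0 (- 4^-1 *: gram C)) (v *m W).
Proof.
have [uW _] := fW; rewrite -ricci_standard // /ricci.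
rewrite (_ : lin1_mx _ =
    W *m lin1_mx (fun w => curv C w (u *m W) (v *m W)) *m invmx W).
  by rewrite mxtrace_mulC mulKmx.
apply: (can_inj (mulmxK uW)); rewrite mulmxKV //; apply/row_matrixP => i.
rewrite !row_mul row_lin1_mx curvature_frame lin1_mxE ?rowE // => a x y.
exact: curvPl.
Qed.

Lemma ricci_operator_frame : ricci_operator br g =
  W *m block_mx (2^-1 *: sumsq C) 0 0 (- 4^-1 *: gram C) *m invmx W.
Proof.
have [uW gW] := fW; apply/row_matrixP => i; rewrite row_lin1_mx rowE.
by apply: (riesz_frame fW) => v; rewrite gW ricci_frame !mulmxA mulmxKV.
Qed.

(** For given c the derivation is forced to be the Ricci operator minus c, which in the frame is the
    block matrix [D c]. *)
Lemma nilsoliton_frame : nilsoliton br g <-> exists c, soliton C c.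
Proof.
have [uW _] := fW; pose D c : 'M[R]_(m + n) :=
  block_mx (2^-1 *: sumsq C - c%:M) 0 0 (- 4^-1 *: gram C - c%:M).
have DE c : block_mx (2^-1 *: sumsq C) 0 0 (- 4^-1 *: gram C) = c%:M + D c.
  by rewrite scalar_mx_block add_block_mx !add0r !subrKC.
have brD c u v : bracket C u v *m D c =
    row_mx 0 (beta C (lsubmx u) (lsubmx v) *m (- 4^-1 *: gram C - c%:M)).
  by rewrite /bracket mul_row_block !mul0mx mulmx0 !add0r.
have lD c u : lsubmx (u *m D c) = lsubmx u *m (2^-1 *: sumsq C - c%:M).
  by rewrite -{1}[u]hsubmxK mul_row_block mulmx0 addr0 row_mxKl.
rewrite /nilsoliton ricci_operator_frame; split=> [[c [E [derE ricE]]]|[c sol]].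
  exists c; apply/(derivation_soliton _ sC) => x y.
  have EE : E = W *m D c *m invmx W.
    apply: (addrI c%:M); rewrite -ricE (DE c) mulmxDr mulmxDl mul_mx_scalar.
    by rewrite -scalemxAl mulmxV // scalemx1.
  have EW u : u *m E *m W = u *m W *m D c by rewrite EE !mulmxA mulmxKV.
  pose X := row_mx x 0 *m invmx W; pose Y := row_mx y 0 *m invmx W.
  have := congr1 (mulmx^~ W) (derE X Y); rewrite mulmxDl !bracket_frame !EW bracket_frame.
  rewrite /X /Y !mulmxKV // brD /bracket !lD !row_mxKl add_row_mx.
  by move/eq_row_mx => [_ ->].
exists c, (W *m D c *m invmx W); split; last first.
  by rewrite (DE c) mulmxDr mulmxDl mul_mx_scalar -scalemxAl mulmxV // scalemx1.
move=> u v; apply: (can_inj (mulmxK uW)).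
rewrite !mulmxA mulmxKV // mulmxDl !bracket_frame !mulmxKV // brD /bracket !lD.
by rewrite add_row_mx addr0; congr row_mx; exact: (derivation_soliton c sC).2 sol _ _.
Qed.

End Frame.

End Ricci.

(** * Variation of the squared norm of the moment map *)

Section Critical.
Variables (R : realType) (m n : nat).
Implicit Types (C D : 'I_n -> 'M[R]_m).

(* |m(mu)|^2 = quartic C / ssq C ^ 2 in an orthonormal frame. *)
Definition quartic C :=
  4 * \tr (sumsq C *m sumsq C) + \tr (gram C *m gram C).

(** By [quartic_variation], -16 times this is the gradient of [quartic] on skew tuples with respect
    to [tdot]. *)
Definition soliton_lhs C l :=
  2^-1 *: (sumsq C *m C l + C l *m sumsq C) + 4^-1 *: (\sum_k gram C k l *: C k).

Lemma gramC C k l : gram C k l = gram C l k.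
Proof. by rewrite !mxE mxtrace_mulC. Qed.

Lemma ssq_line C D h :
  ssq (fun l => C l + h *: D l) = ssq C + 2 * tdot C D * h + ssq D * h ^+ 2.
Proof.
rewrite -[LHS]/(tdot _ _) tdotDl tdotZl ![tdot _ (fun l => _ + _)]tdotC.
by rewrite !tdotDl !tdotZl [tdot D C]tdotC -/(ssq _) -[ssq D]/(tdot D D) -[ssq C]/(tdot C C); ring.
Qed.

Lemma sumsq_line C D h : sumsq (fun l => C l + h *: D l) =
  sumsq C + h *: \sum_l (C l *m D l + D l *m C l) + h ^+ 2 *: sumsq D.
Proof.
rewrite /sumsq !scaler_sumr -!big_split; apply: eq_bigr => l _ /=.
rewrite mulmxDl !mulmxDr -!scalemxAr -!scalemxAl scalerA -expr2 scalerDr.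
by rewrite addrA; congr (_ + _); rewrite -!addrA.
Qed.

Lemma gram_line C D h : gram (fun l => C l + h *: D l) = gram C
  + h *: (\matrix_(k, l) (\tr (C k *m D l) + \tr (D k *m C l))) + h ^+ 2 *: gram D.
Proof.
apply/matrixP => k l; rewrite !mxE mulmxDl !mulmxDr -!scalemxAr -!scalemxAl.
by rewrite !raddfD /= !mxtraceZ; ring.
Qed.

Lemma tr_sqr_line p (A B E : 'M[R]_p) h :
  \tr ((A + h *: B + h ^+ 2 *: E) *m (A + h *: B + h ^+ 2 *: E)) =
  \tr (A *m A) + 2 * \tr (A *m B) * h + (2 * \tr (A *m E) + \tr (B *m B)) * h ^+ 2
  + 2 * \tr (B *m E) * h ^+ 3 + \tr (E *m E) * h ^+ 4.
Proof.
rewrite !mulmxDl !mulmxDr -!scalemxAr -!scalemxAl !raddfD /= !mxtraceZ.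
rewrite [\tr (B *m A)]mxtrace_mulC [\tr (E *m A)]mxtrace_mulC.
rewrite [\tr (E *m B)]mxtrace_mulC; ring.
Qed.

(** The left side is the coefficient of h in [quartic] along C + h D; skewness converts products
    into [tdot] and accounts for the sign. *)
Lemma quartic_variation C D : skew C -> skew D ->
  8 * \tr (sumsq C *m \sum_l (C l *m D l + D l *m C l))
  + 2 * \tr (gram C *m \matrix_(k, l) (\tr (C k *m D l) + \tr (D k *m C l)))
  = - 16 * tdot (soliton_lhs C) D.
Proof.
move=> sC sD.
have e1 : \tr (sumsq C *m \sum_l (C l *m D l + D l *m C l)) =
    - tdot (fun l => sumsq C *m C l + C l *m sumsq C) D.
  rewrite mulmx_sumr raddf_sum /tdot -sumrN; apply: eq_bigr => l _ /=.
  rewrite sD mulmxN raddfN opprK mulmxDr mulmxDl !raddfD /= mulmxA; congr (_ + _).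
  by rewrite mulmxA mxtrace_mulC mulmxA.
have e2 : \tr (gram C *m \matrix_(k, l) (\tr (C k *m D l) + \tr (D k *m C l))) =
    - (2 * tdot (fun l => \sum_k gram C k l *: C k) D).
  transitivity (\sum_l \sum_k 2 * (gram C k l * \tr (C k *m D l))).
    pose A k l := gram C k l * \tr (C k *m D l).
    transitivity (\sum_k \sum_l (A k l + A l k)).
      apply: eq_bigr => k _; rewrite mxE; apply: eq_bigr => l _.
      by rewrite [X in _ * X]mxE /A [gram C l k]gramC mulrDr [\tr (D l *m _)]mxtrace_mulC addrC.
    under eq_bigr => k _ do rewrite big_split.
    rewrite big_split /= [X in X + _]exchange_big -big_split; apply: eq_bigr => l _ /=.
    by rewrite -big_split; apply: eq_bigr => k _; rewrite /= /A; ring.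
  rewrite /tdot mulr_sumr -sumrN; apply: eq_bigr => l _.
  rewrite sD mulmxN raddfN mulrN opprK mulmx_suml raddf_sum mulr_sumr.
  by apply: eq_bigr => k _ /=; rewrite -scalemxAl mxtraceZ.
have -> : tdot (soliton_lhs C) D =
    2^-1 * tdot (fun l => sumsq C *m C l + C l *m sumsq C) D
    + 4^-1 * tdot (fun l => \sum_k gram C k l *: C k) D.
  by rewrite -!tdotZl -tdotDl.
by rewrite e1 e2; field.
Qed.

Lemma quartic_line C D : skew C -> skew D -> exists a b c, forall h,
  quartic (fun l => C l + h *: D l) =
  quartic C + (- 16 * tdot (soliton_lhs C) D) * h + a * h ^+ 2 + b * h ^+ 3 + c * h ^+ 4.
Proof.
move=> sC sD; rewrite -quartic_variation //.
set S1 := \sum_l _; set G1 := \matrix_(k, l) _.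
exists (4 * (2 * \tr (sumsq C *m sumsq D) + \tr (S1 *m S1))
   + (2 * \tr (gram C *m gram D) + \tr (G1 *m G1))),
  (4 * (2 * \tr (S1 *m sumsq D)) + 2 * \tr (G1 *m gram D)), (quartic D) => h.
rewrite /quartic sumsq_line gram_line !tr_sqr_line -/S1 -/G1; ring.
Qed.

(** Euler's identity for a form of degree 4: the variation in the direction D = C. *)
Lemma tdot_soliton_lhs C : skew C -> tdot (soliton_lhs C) C = - quartic C / 4.
Proof.
move=> sC; have := quartic_variation sC sC.
have -> : \sum_l (C l *m C l + C l *m C l) = 2 *: sumsq C.
  by rewrite big_split /= -/(sumsq C) scaler_nat mulr2n.
have -> : \matrix_(k, l) (\tr (C k *m C l) + \tr (C k *m C l)) = 2 *: gram C.
  by apply/matrixP => k l; rewrite !mxE; ring.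
rewrite -!scalemxAr !mxtraceZ /quartic; lra.
Qed.

Lemma tdot_skew_eq0 C : skew C -> (forall D, skew D -> tdot C D = 0) -> forall l, C l = 0.
Proof.
move=> sC h l; apply: tr_mul_trmx_eq0; apply/eqP; have := h C sC.
move/eqP; rewrite psumr_eq0; last by move=> k _; exact: tr_mul_trmx_ge0.
by move/allP/(_ l (mem_index_enum _)).
Qed.

Lemma skew_soliton_lhs C : skew C -> skew (soliton_lhs C).
Proof.
move=> sC l; rewrite /soliton_lhs opprD linearD /= !linearZ /=.
congr (_ *: _ + _ *: _).
  by rewrite linearD /= !trmx_mul sumsq_sym // sC mulmxN mulNmx -opprD addrC.
rewrite linear_sum -sumrN; apply: eq_bigr => k _ /=.
by rewrite linearZ /= sC scalerN.
Qed.

(** The right side says that quartic / ssq^2 has zero derivative in every skew direction, hence that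
    the gradient of [quartic] is a multiple of [C]. *)
Lemma soliton_variation C : skew C -> 0 < ssq C ->
  (exists c, soliton C c) <->
  (forall D, skew D ->
     - 16 * tdot (soliton_lhs C) D * ssq C = 4 * quartic C * tdot C D).
Proof.
move=> sC N0; split=> [[c sol] D sD|h].
  have sE : soliton_lhs C = fun l => c *: C l by apply/funext => l; exact: sol.
  have := tdot_soliton_lhs sC; rewrite sE !tdotZl -[tdot C C]/(ssq C) => e.
  by rewrite (_ : quartic C = - 4 * (c * ssq C)); [ring|rewrite e; field].
(* The multiple is found by pairing the soliton equation with [C] and using [tdot_soliton_lhs]. *)
exists (- quartic C / (4 * ssq C)) => l.
pose X l := 16 *: (ssq C *: soliton_lhs C l) + (4 * quartic C) *: C l.
have sX : skew X.
  move=> k; rewrite /X opprD linearD /= !linearZ /= (skew_soliton_lhs sC) sC.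
  by rewrite ?scalerN.
have /(_ l) : forall l, X l = 0.
  apply: tdot_skew_eq0 => // D sD; rewrite /X tdotDl !tdotZl -h //; ring.
have N : ssq C != 0 by rewrite gt_eqF.
rewrite /X scalerA => /(congr1 (fun Y => (16 * ssq C)^-1 *: Y)).
rewrite scaler0 scalerDr !scalerA mulVf ?mulf_neq0 ?pnatr_eq0 // scale1r.
move/eqP; rewrite addr_eq0 -scaleNr => /eqP e.
by rewrite -[LHS]/(soliton_lhs C l) e; congr (_ *: _); field; rewrite N.
Qed.

End Critical.

(** * Directional derivatives through functions of one variable *)

Section DirectionalDerivative.
Variable R : realType.

Lemma is_derive_line (V : normedModType R) (F : V -> R^o) (a v : V) (d : R) :
  is_derive a v F d <-> is_derive (0 : R) (1 : R) ((fun h => F (a + h *: v)) : R -> R^o) d.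
Proof.
have e : (fun h : R => h^-1 *: ((F \o shift a) (h *: v) - F a)) =
    (fun h : R => h^-1 *: ((((fun h => F (a + h *: v)) : R -> R^o) \o shift 0) (h *: 1)
       - F (a + 0 *: v))).
  apply/funext => h /=; rewrite scale0r !addr0 [h *: v + a]addrC.
  by rewrite [h *: 1 in RHS]mulr1.
by split=> -[h1 h2]; split; move: h1 h2; rewrite /derivable /derive e.
Qed.

Lemma is_derive_rational (p q : {poly R}) (x : R) : q.[x] != 0 ->
  is_derive x (1 : R) (fun h => p.[h] / q.[h] : R^o)
    ((p^`().[x] * q.[x] - p.[x] * q^`().[x]) / q.[x] ^+ 2).
Proof.
move=> q0; have := is_deriveM (is_derive_poly p x) (is_deriveV q0 (is_derive_poly q x)).
rewrite [X in is_derive _ _ _ X -> _](_ : _ = (p^`().[x] * q.[x] - p.[x] * q^`().[x]) / q.[x] ^+ 2) //.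
by rewrite /GRing.scale /=; field.
Qed.

Lemma is_derive_uniq (V : normedModType R) (F : V -> R^o) (a v : V) (d d' : R) :
  is_derive a v F d -> is_derive a v F d' -> d = d'.
Proof. by move=> [_ <-] [_ <-]. Qed.

End DirectionalDerivative.

(** * The moment map and its critical points in an orthonormal frame *)

Section Moment.
Variables (R : realType) (m n : nat).
Variables (g : 'rV[R]_(m + n) -> 'rV[R]_(m + n) -> R).
Variables (W1 : 'M[R]_m) (W2 : 'M[R]_n).
Hypotheses (f1 : frame (on_n1 g) W1) (f2 : frame (on_n2 g) W2).
Implicit Types (mu nu : 'M[R]_(m * m, n)) (F H : 'I_n -> 'M[R]_m).

Let u1 : W1 \in unitmx. Proof. by case: f1. Qed.
Let u2 : W2 \in unitmx. Proof. by case: f2. Qed.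

Definition coords mu := act (invmx W1) W2 (slices mu).

Lemma skew_coords mu : Vnm mu -> skew (coords mu).
Proof. by move=> /slices_skew; exact: skew_act. Qed.

Lemma bil_coords mu x y : bil mu x y *m W2 = beta (coords mu) (x *m W1) (y *m W1).
Proof. by rewrite -beta_act !mulmxK // bil_beta. Qed.

Lemma coords_line mu nu h :
  coords (mu + h *: nu) = fun l => coords mu l + h *: coords nu l.
Proof.
have sl k : slices (mu + h *: nu) k = slices mu k + h *: slices nu k.
  by apply/matrixP => i j; rewrite !mxE.
apply/funext => l; rewrite /coords /act scaler_sumr -big_split.
apply: eq_bigr => k _ /=; rewrite sl mulmxDr mulmxDl scalerDr.
by rewrite -scalemxAr -scalemxAl !scalerA mulrC.
Qed.

Lemma Vnm_line mu nu h : Vnm mu -> Vnm nu -> Vnm (mu + h *: nu).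
Proof.
move=> Vmu Vnu x y; have := Vmu x y; have := Vnu x y.
by rewrite /bil !mulmxDr -!scalemxAr => -> ->; rewrite opprD scalerN.
Qed.

Lemma coords_surj F : skew F -> exists2 nu, Vnm nu & coords nu = F.
Proof.
move=> sF; exists (tensor_of (act W1 (invmx W2) F)).
  by apply/skew_tensor_of; exact: skew_act.
by rewrite /coords tensor_ofK act_comp mulVmx // mulVmx // act1.
Qed.

(** [onb] is an unspecified orthonormal basis; in the frame it is an orthogonal matrix Q, and
    conjugating the slices by Q preserves [tdot]. *)
Lemma V_dot_coords (f h : 'rV[R]_m -> 'rV[R]_m -> 'rV[R]_n) F H :
  (forall x y, f x y *m W2 = beta F (x *m W1) (y *m W1)) ->
  (forall x y, h x y *m W2 = beta H (x *m W1) (y *m W1)) ->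
  V_dot g f h = tdot F H.
Proof.
move=> fF hH; rewrite /V_dot; set X := onb _.
have [Q XQ QQ] : exists2 Q, (forall i, X i *m W1 = row i Q) & Q *m Q^T = 1%:M.
  exists ((\matrix_i X i) *m W1) => [i|]; first by rewrite row_mul rowK.
  by apply/(orthonormal_basis_frame _ f1); exact: onbP f1.
have QQ' := mulmx1C QQ.
have bQ (G : 'I_n -> 'M[R]_m) i j l :
    beta G (row i Q) (row j Q) 0 l = (Q *m G l *m Q^T) i j.
  rewrite mxE -row_mul dotp_sum [RHS]mxE; apply: eq_bigr => k _.
  by rewrite [Q^T _ _]mxE; congr (_ * _); rewrite mxE.
transitivity (\sum_l \sum_i \sum_j
    (Q *m F l *m Q^T) i j * (Q *m H l *m Q^T) i j); last first.
  apply: eq_bigr => l _; rewrite -tr_mul_trmx_sum !trmx_mul trmxK -!mulmxA.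
  by rewrite (mulmxA Q^T Q) QQ' mul1mx mxtrace_mulC -!mulmxA QQ' mulmx1.
rewrite [RHS]exchange_big; apply: eq_bigr => i _ /=.
rewrite [RHS]exchange_big; apply: eq_bigr => j _ /=.
case: f2 => _ ->; rewrite fF hH !XQ dotp_sum; apply: eq_bigr => l _.
by rewrite !bQ.
Qed.

Lemma self_adjoint_coords p (k : 'rV[R]_p -> 'rV[R]_p -> R) W (A : 'M[R]_p) :
  frame k W -> self_adjoint k A <-> (invmx W *m A *m W)^T = invmx W *m A *m W.
Proof.
move=> [uW kW]; set B := invmx W *m A *m W.
have AW x : x *m A *m W = x *m W *m B by rewrite /B !mulmxA mulmxK.
split=> [sA|sB x y]; last by rewrite !kW !AW dotpMl sB.
apply/row_matrixP => i; rewrite !rowE; apply: dotp_inj => y.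
have := sA (delta_mx 0 i *m invmx W) (y *m invmx W).
by rewrite !kW !AW !mulmxKV // => ->; rewrite dotpMl trmxK.
Qed.

(** Existence is a trace computation in the frame; uniqueness holds because the trace form is
    positive definite on symmetric matrices. *)
Lemma is_moment_coords mu ab : Vnm mu -> is_moment g mu ab <->
  let N := ssq (coords mu) in
  ab = (W1 *m ((2 / N) *: sumsq (coords mu)) *m invmx W1,
        W2 *m (- N^-1 *: gram (coords mu)) *m invmx W2).
Proof.
move=> Vmu /=; set C := coords mu; set N := ssq C; have sC : skew C := skew_coords Vmu.
set S := sumsq C; set G := gram C.
have sS : S^T = S := sumsq_sym sC; have sG : G^T = G := gram_sym C.
have VN : V_dot g (bil mu) (bil mu) = N by exact: V_dot_coords (bil_coords mu) (bil_coords mu).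
have Vpi al be : V_dot g (pi_rep al be (bil mu)) (bil mu) =
    2 * \tr (invmx W1 *m al *m W1 *m S) - \tr (invmx W2 *m be *m W2 *m G).
  have [al' alE] : exists A, invmx W1 *m al *m W1 = A by eexists.
  have [be' beE] : exists A, invmx W2 *m be *m W2 = A by eexists.
  rewrite alE beE.
  rewrite (@V_dot_coords _ _ (fun l => act 1%:M be' C l + (-1) *: (al' *m C l)
    + (-1) *: (C l *m al'^T)) C _ (bil_coords mu)); last first.
    move=> x y; rewrite /pi_rep !mulmxBl.
    have -> : bil mu x y *m be *m W2 = beta (act 1%:M be' C) (x *m W1) (y *m W1).
      by rewrite -[RHS]beta_act !mulmx1 -bil_coords -beE !mulmxA mulmxK.
    have aW z : z *m al *m W1 = z *m W1 *m al' by rewrite -alE !mulmxA mulmxK.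
    rewrite !bil_coords !aW; apply/rowP => l; rewrite !mxE.
    rewrite !mulmxDr !dotpDl -!scalemxAr !dotpZl !mulN1r !mulmxA; congr (_ - _ - _).
    by rewrite [RHS]dotpMl trmxK.
  rewrite !tdotDl !tdotZl !mulN1r.
  have -> : tdot (act 1%:M be' C) C = - \tr (be' *m G).
    rewrite mxtrace_mulC /tdot -sumrN.
    apply: eq_bigr => l _; rewrite mxE /act mulmx_suml raddf_sum -sumrN /=.
    apply: eq_bigr => k _; rewrite -scalemxAl mxtraceZ trmx1 mul1mx mulmx1 sC.
    by rewrite mulmxN raddfN /= [G l k]mxE mxtrace_mulC; ring.
  have eS : \tr (al' *m S) = \sum_l \tr (al' *m (C l *m C l)).
    by rewrite /S /sumsq mulmx_sumr raddf_sum.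
  have e1 : tdot (fun l => al' *m C l) C = - \tr (al' *m S).
    rewrite eS -sumrN; apply: eq_bigr => l _.
    by rewrite sC mulmxN raddfN /= mulmxA.
  have e2 : tdot (fun l => C l *m al'^T) C = - \tr (al' *m S).
    rewrite eS -sumrN; apply: eq_bigr => l _.
    rewrite -[LHS]mxtrace_tr trmx_mul (trmx_mul (C l)) !trmxK sC !mulmxN raddfN /=.
    by rewrite [\tr (C l *m _)]mxtrace_mulC -mulmxA.
  by rewrite e1 e2; ring.
have trc p (W A B : 'M[R]_p) :
    \tr (W *m A *m invmx W *m B) = \tr (A *m (invmx W *m B *m W)).
  by rewrite -!mulmxA [LHS]mxtrace_mulC -!mulmxA.
pose a0 := (2 / N) *: S; pose b0 := - N^-1 *: G.
have sa0 : a0^T = a0 by rewrite linearZ /= sS.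
have sb0 : b0^T = b0 by rewrite linearZ /= sG.
have mom0 al be : \tr (a0 *m (invmx W1 *m al *m W1)) + \tr (b0 *m (invmx W2 *m be *m W2))
    = (V_dot g (bil mu) (bil mu))^-1 * V_dot g (pi_rep al be (bil mu)) (bil mu).
  rewrite VN Vpi /a0 /b0 -!scalemxAl !mxtraceZ [\tr (S *m _)]mxtrace_mulC.
  by rewrite [\tr (G *m _)]mxtrace_mulC; ring.
have conjK p (W A : 'M[R]_p) : W \in unitmx -> invmx W *m (W *m A *m invmx W) *m W = A.
  by move=> uW; rewrite -!mulmxA mulVmx // mulmx1 mulmxA mulVmx // mul1mx.
have conjK' p (W A : 'M[R]_p) : W \in unitmx -> W *m (invmx W *m A *m W) *m invmx W = A.
  by move=> uW; rewrite -!mulmxA mulmxV // mulmx1 mulmxA mulmxV // mul1mx.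
(* The formula also covers mu = 0: then N = 0 and its inverse is 0 by convention. *)
have mu0 : mu = 0 -> a0 = 0 /\ b0 = 0.
  move=> h; have N0 : N = 0.
    rewrite -VN /V_dot h big1 // => i _; rewrite big1 // => j _.
    rewrite /bil mulmx0; case: f2 => _ ->; by rewrite mul0mx dotp0.
  by rewrite /a0 /b0 N0 invr0 mulr0 oppr0 !scale0r.
case: ab => a b; split=> [[/= sa sb h]|[-> ->]].
  have sa' := (self_adjoint_coords a f1).1 sa.
  have sb' := (self_adjoint_coords b f2).1 sb.
  have [e|ne] := eqVneq mu 0.
    have [a00 b00] := mu0 e; move: h; rewrite e eqxx => -[-> ->].
    by rewrite -/a0 -/b0 a00 b00 !mulmx0 !mul0mx.
  rewrite (negPf ne) in h.
  set a' := invmx W1 *m a *m W1 in sa'; set b' := invmx W2 *m b *m W2 in sb'.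
  have aE : a = W1 *m a' *m invmx W1 by rewrite conjK'.
  have bE : b = W2 *m b' *m invmx W2 by rewrite conjK'.
  (* Testing the moment condition on the difference of the two candidates makes the norm of that
     difference vanish. *)
  have := h (W1 *m (a' - a0) *m invmx W1) (W2 *m (b' - b0) *m invmx W2).
  rewrite -mom0 aE bE !trc // !conjK // => /(_ _ _)/eqP.
  rewrite -subr_eq0 opprD addrACA -!raddfB -!mulmxBl /= => e.
  have sda : (a' - a0)^T = a' - a0 by rewrite linearB /= sa' sa0.
  have sdb : (b' - b0)^T = b' - b0 by rewrite linearB /= sb' sb0.
  have : \tr ((a' - a0) *m (a' - a0)^T) + \tr ((b' - b0) *m (b' - b0)^T) == 0.
    rewrite sda sdb; apply: e.
      by apply/(self_adjoint_coords _ f1); rewrite conjK.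
    by apply/(self_adjoint_coords _ f2); rewrite conjK.
  rewrite paddr_eq0 ?tr_mul_trmx_ge0 // => /andP[/eqP h1 /eqP h2].
  by move/tr_mul_trmx_eq0/subr0_eq: h1 => ->; move/tr_mul_trmx_eq0/subr0_eq: h2 => ->.
split=> /=.
- by apply/(self_adjoint_coords _ f1); rewrite conjK.
- by apply/(self_adjoint_coords _ f2); rewrite conjK.
- case: eqP => [/mu0[e1 e2]|_ al be _ _]; last by rewrite !trc.
  by rewrite -/a0 -/b0 e1 e2 !mulmx0 !mul0mx.
Qed.

Lemma F_m_coords mu : Vnm mu ->
  F_m g mu = quartic (coords mu) / ssq (coords mu) ^+ 2.
Proof.
move=> Vmu; rewrite /F_m; have : is_moment g mu (moment g mu).
  by rewrite /moment; apply: xgetPex; eexists; apply/(is_moment_coords _ Vmu).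
move/(is_moment_coords _ Vmu) => -> /=.
have trJ p (W A : 'M[R]_p) : W \in unitmx ->
    \tr (W *m A *m invmx W *m (W *m A *m invmx W)) = \tr (A *m A).
  by move=> uW; rewrite -!mulmxA mulKmx // mxtrace_mulC -!mulmxA mulVmx // mulmx1.
rewrite !trJ // /quartic -!scalemxAl -!scalemxAr !mxtraceZ -exprVn; ring.
Qed.

Lemma critical_coords mu : Vnm mu -> 0 < ssq (coords mu) ->
  critical_point g mu <-> exists c, soliton (coords mu) c.
Proof.
move=> Vmu N0; have sC := skew_coords Vmu; set C := coords mu in N0 sC *.
rewrite soliton_variation //.
have N : ssq C != 0 by rewrite gt_eqF.
(* Along a line inside [Vnm] the functional is a quotient of two polynomials of degree at most 4, so
   its derivative at 0 needs only their constant and linear coefficients. *)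
have dF nu : Vnm nu -> is_derive mu nu (F_m g : 'M[R]_(m * m, n) -> R^o)
    ((- 16 * tdot (soliton_lhs C) (coords nu) * ssq C
      - 4 * quartic C * tdot C (coords nu)) / ssq C ^+ 3).
  move=> Vnu; have sD := skew_coords Vnu; apply/is_derive_line.
  have [a [b [c qE]]] := quartic_line sC sD.
  set D := coords nu in sD qE *.
  pose p : {poly R} := (quartic C)%:P + (- 16 * tdot (soliton_lhs C) D)%:P * 'X
    + a%:P * 'X^2 + b%:P * 'X^3 + c%:P * 'X^4.
  pose q : {poly R} := ((ssq C)%:P + (2 * tdot C D)%:P * 'X + (ssq D)%:P * 'X^2) ^+ 2.
  have FE : (fun h => F_m g (mu + h *: nu)) = (fun h => p.[h] / q.[h]).
    apply/funext => h; rewrite F_m_coords; last exact: Vnm_line.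
    by rewrite coords_line -/C -/D qE ssq_line /p /q !hornerE.
  rewrite FE.
  have q0 : q.[0] = ssq C ^+ 2 by rewrite /q !hornerE /=; ring.
  have := @is_derive_rational R p q 0; rewrite q0 sqrf_eq0 => /(_ N).
  have -> : p.[0] = quartic C by rewrite /p !hornerE /=; ring.
  have -> : p^`().[0] = - 16 * tdot (soliton_lhs C) D.
    by rewrite /p !(derivD, derivM, derivXn, derivX, derivC) !hornerE /=; ring.
  have -> : q^`().[0] = 2 * ssq C * (2 * tdot C D).
    by rewrite /q expr2 !(derivD, derivM, derivXn, derivX, derivC) !hornerE /=; ring.
  rewrite [X in is_derive _ _ _ X -> _](_ : _ =
    (- 16 * tdot (soliton_lhs C) D * ssq C - 4 * quartic C * tdot C D) / ssq C ^+ 3) //.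
  by field.
split=> [crit D sD|h nu Vnu].
  have [nu Vnu eD] := coords_surj sD.
  have := is_derive_uniq (dF nu Vnu) (crit nu Vnu).
  rewrite eD => /eqP; rewrite mulf_eq0 invr_eq0 expf_eq0 (negPf N) andbF orbF.
  by rewrite subr_eq0 => /eqP.
have := dF nu Vnu; rewrite h ?subrr ?mul0r //; exact: skew_coords.
Qed.

End Moment.

Theorem theorem2p16 (R : realType) (m n : nat) (hm : (1 <= m)%N) (hn : (1 <= n)%N)
    (mu : 'M[R]_(m * m, n)) (hmu : Vnm mu) (htype : of_type mu)
    (hns : nonsingular mu) :
  (forall g : {dot 'rV[R]_(m + n) for idfun}, n1_perp_n2 g -> forall a b : R,
     (forall Z, orthonormal_basis (on_n2 g) Z -> J_condition g mu a b Z) <->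
     (exists Z, orthonormal_basis (on_n2 g) Z /\ J_condition g mu a b Z)) /\
  [<-> exists (g : {dot 'rV[R]_(m + n) for idfun}) (a b : R),
         [/\ n1_perp_n2 g, a < 0, b < 0 &
             forall Z, orthonormal_basis (on_n2 g) Z -> J_condition g mu a b Z];
       exists g : {dot 'rV[R]_(m + n) for idfun}, nilsoliton (lie_bracket mu) g;
       exists g : {dot 'rV[R]_(m + n) for idfun},
         n1_perp_n2 g /\ critical_point g mu;
       closed (SL_orbit mu : set (subspace (@Vnm R m n)))].
Proof.
have sC : skew (slices mu) by exact/slices_skew.
have nC := nonsingular_slices hns.
split=> [g perp a b|].
  have [W1 [W2 [f1 f2 _]]] := dot_perp_frame perp.
  split=> [h|[Z [oZ /(J_condition_frame mu f1 f2 a b oZ) e]] Z' oZ']; last first.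
    exact/(J_condition_frame mu f1 f2 a b oZ').
  by exists (fun i => row i (invmx W2)); have oZ := frame_onb f2; split=> //; exact: h.
tfae.
- move=> [g [a [b [perp _ _ h]]]]; have [W1 [W2 [f1 f2 f]]] := dot_perp_frame perp.
  exists g; apply/(nilsoliton_frame (proj1 f1) f hmu); exists (a + b / 4).
  apply: einstein_soliton; have oZ := frame_onb f2.
  exact/(J_condition_frame mu f1 f2 a b oZ)/h.
(* Discarding the block K of the frame gives an inner product with n1 orthogonal to n2 and the same
   tuple, hence the same soliton equation. *)
- move=> [g sol]; have [W1 [K [W2 [u1 u2 f]]]] := dot_adapted_frame g.
  have [g' [perp _ f1 f2]] := dot_of_blocks u1 u2.
  exists g'; split=> //; apply/(critical_coords f1 f2 hmu).
    by apply: ssq_gt0 => //; apply: nonsing_act; rewrite ?unitmx_inv.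
  exact/(nilsoliton_frame u1 f hmu).
- move=> [g [perp crit]]; have [W1 [W2 [f1 f2 _]]] := dot_perp_frame perp.
  have [u1 _] := f1; have [u2 _] := f2.
  have nC' : nonsing (coords W1 W2 mu) by apply: nonsing_act; rewrite ?unitmx_inv.
  have sC' := skew_coords W1 W2 hmu.
  have [c sol] := (critical_coords f1 f2 hmu (ssq_gt0 hm hn nC')).1 crit.
  have [a [b [_ _ e]]] := soliton_einstein hm hn sC' nC' sol.
  (* The Einstein tuple is the one read in the frame; its closed orbit is carried to that of mu by
     the element (W1, W2^-1) of GL x GL. *)
  apply/(closed_SL_orbit hmu).
  have -> : slices mu = act W1 (invmx W2) (coords W1 W2 mu).
    by rewrite act_comp mulmxV // mulmxV // act1.
  by apply: uclosed_orbit_act; rewrite ?unitmx_inv //; exact: einstein_closed sC' e.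
- move/(closed_SL_orbit hmu) => cl.
  have [_ [a [b [[A [phi [dA dphi ->]]] e]]]] := closed_orbit_einstein hm hn sC cl.
  have uA := det1_unitmx dA; have uphi := det1_unitmx dphi.
  (* Taking A^-1 and phi as frames makes the Einstein point of the orbit the tuple of mu itself for
     the resulting inner product. *)
  have uA' : invmx A \in unitmx by rewrite unitmx_inv.
  have [g [perp _ f1 f2]] := dot_of_blocks uA' uphi.
  have [a0 b0] := einstein_neg hm hn (skew_act A phi sC) (nonsing_act uA uphi nC) e.
  exists g, a, b; split=> // Z oZ.
  by apply/(J_condition_frame mu f1 f2 a b oZ); rewrite invmxK.
Qed.
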